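(* Let $0<|q|<1$. The following identities hold. (i) $$A^{(2)}(q)=q\frac{(-q;q^2)_{\infty}}{(q^2;q^2)_{\infty}}\sum_{n=0}^{\infty}\frac{(-1)^nq^{2n^2+3n}}{1-q^{2n+1}}.$$ (ii) $$B^{(2)}(q)=\frac{(-q^2;q^2)_{\infty}}{(q^2;q^2)_{\infty}}\sum_{n=-\infty}^{\infty}\frac{(-1)^nq^{2n^2+2n}}{1-q^{2n+1}}.$$ (iii) $$\sum_{n=0}^{\infty}\frac{q^{2n(n+1)}}{(q;q^2)_{n+1}^2}=\frac{1}{(q^2;q^2)_\infty}\sum_{n=0}^{\infty}(-1)^n\frac{1+q^{2n+1}}{1-q^{2n+1}}q^{3n^2+3n}=-q^{-1}m(q,q^6,q^2)-q^{-1}m(q,q^6,q^4)=-2q^{-1}m(q,q^6,q^2)+\frac{J_6^3}{J_2J_{3,6}}.$$ (iv) $$\sum_{n=0}^{\infty}\frac{(-1)^nq^{n(n+1)}(q^2;q^2)_n}{(q;q^2)_{n+1}^2}=\sum_{n=0}^{\infty}\frac{1+q^{2n+1}}{1-q^{2n+1}}q^{2n^2+2n}=\overline{m}(-q^2,q^4,-q^4)+q\,\overline{m}(-1,q^4,-q^6).$$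
   Context: Notation: $(x;p)_n=\prod_{k=0}^{n-1}(1-xp^k)$ (with $(x;p)_0=1$) and $(x;p)_\infty=\prod_{k\ge0}(1-xp^k)$ for $|p|<1$; $(x;p)_n^2$ is the square of $(x;p)_n$. The second order mock theta functions are $$A^{(2)}(q)=\sum_{n=0}^{\infty}\frac{q^{(n+1)^2}(-q;q^2)_{n}}{(q;q^2)_{n+1}^2},\qquad B^{(2)}(q)=\sum_{n=0}^{\infty}\frac{q^{n^2+n}(-q^2;q^2)_{n}}{(q;q^2)_{n+1}^2}$$ (equivalently $A^{(2)}(q)=\sum_{n\ge0}\frac{q^{n+1}(-q^2;q^2)_n}{(q;q^2)_{n+1}}$ and $B^{(2)}(q)=\sum_{n\ge0}\frac{q^n(-q;q^2)_n}{(q;q^2)_{n+1}}$). Theta function: $j(x;p)=(x;p)_\infty(p/x;p)_\infty(p;p)_\infty$; $J_{a,k}=j(q^a;q^k)$, $J_k=(q^k;q^k)_\infty$. For nonzero $x,z$ with neither $z$ nor $xz$ an integral power of $p$, $$m(x,p,z)=\frac1{j(z;p)}\sum_{r=-\infty}^\infty\frac{(-1)^rp^{r(r-1)/2}z^r}{1-p^{r-1}xz};$$ for nonzero $x,z$ with $xz$ not an integral power of $p$, $$\overline m(x,p,z)=\sum_{r=-\infty}^\infty\frac{(-1)^r\operatorname{sg}(r)p^{r(r-1)/2}z^r}{1-p^{r-1}xz},$$ where $\operatorname{sg}(r)=1$ for $r\ge0$ and $\operatorname{sg}(r)=-1$ for $r<0$. *)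

(* Defs.v *)
From Stdlib Require Import Reals ZArith.
From Coquelicot Require Export Coquelicot.
Open Scope C_scope.

(* The sum of a complex series; meaningful when [ex_series a]. *)
Definition CSeries (a : nat -> C) : C := iota (T := C_CompleteNormedModule) (fun l => is_series a l).

(* Bilateral series: the parts over [n >= 0] and over [n < 0] converge
   separately. *)
Definition ex_series_Z (a : Z -> C) : Prop :=
  ex_series (fun n : nat => a (Z.of_nat n)) /\
  ex_series (fun n : nat => a (- Z.of_nat (S n))%Z).

Definition CSeries_Z (a : Z -> C) : C :=
  CSeries (fun n : nat => a (Z.of_nat n)) +
  CSeries (fun n : nat => a (- Z.of_nat (S n))%Z).

Definition Cpowz (x : C) (n : Z) : C :=
  match n with
  | Z0 => 1
  | Zpos k => x ^ Pos.to_nat k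
  | Zneg k => / x ^ Pos.to_nat k
  end.

(* [qpoch x p n] is (x;p)_n. *)
Fixpoint qpoch (x p : C) (n : nat) : C :=
  match n with
  | O => 1
  | S k => qpoch x p k * (1 - x * p ^ k)
  end.

(* [qpoch_inf x p] is (x;p)_oo; meaningful for [Cmod p < 1]. *)
Definition qpoch_inf (x p : C) : C :=
  iota (T := C_CompleteNormedModule)
    (fun l => filterlim (qpoch x p) eventually (locally l)).

Definition theta (x p : C) : C :=
  qpoch_inf x p * qpoch_inf (p / x) p * qpoch_inf p p.

(* [J2 q a k] is J_{a,k} and [J1 q k] is J_k. *)
Definition J2 (q : C) (a k : nat) : C := theta (q ^ a) (q ^ k).
Definition J1 (q : C) (k : nat) : C := qpoch_inf (q ^ k) (q ^ k).

(* Appell-Lerch sum m(x,p,z); meaningful for [x], [z] nonzero,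
   [0 < Cmod p < 1], and [z], [x * z] not integral powers of [p].
   Here r(r-1) is even, so the integer division is exact. *)
Definition m_term (x p z : C) (r : Z) : C :=
  Cpowz (- (1)) r * Cpowz p (r * (r - 1) / 2) * Cpowz z r
    / (1 - Cpowz p (r - 1) * x * z).

Definition m (x p z : C) : C := / theta z p * CSeries_Z (m_term x p z).

Definition sg (r : Z) : C := if (0 <=? r)%Z then 1 else - (1).

Definition mbar_term (x p z : C) (r : Z) : C :=
  Cpowz (- (1)) r * sg r * Cpowz p (r * (r - 1) / 2) * Cpowz z r
    / (1 - Cpowz p (r - 1) * x * z).

Definition mbar (x p z : C) : C := CSeries_Z (mbar_term x p z).

(* Second order mock theta functions. *)
Definition A2_term (q : C) (n : nat) : C :=
  q ^ ((n + 1) ^ 2) * qpoch (- q) (q ^ 2) n / qpoch q (q ^ 2) (n + 1) ^ 2.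

Definition A2 (q : C) : C := CSeries (A2_term q).

Definition B2_term (q : C) (n : nat) : C :=
  q ^ (n ^ 2 + n) * qpoch (- q ^ 2) (q ^ 2) n / qpoch q (q ^ 2) (n + 1) ^ 2.

Definition B2 (q : C) : C := CSeries (B2_term q).

(* Main.v *)
Require Import Defs.
From Stdlib Require Import Reals ZArith Lia Lra.
From Coquelicot Require Import Coquelicot.
Open Scope C_scope.

(** Put p = q^2. The sequences b_n = 1/(q;p)_{n+1}^2 and
    a_r = (-1)^r q^(r^2+r) (1+q^(2r+1)) / (1-q^(2r+1)) form a Bailey pair relative
    to p, up to the factor 1-p. Bailey's lemma with rho_2 -> oo and
    rho_1 = -q, -p, oo, p gives the first identity of (i), (ii), (iii), (iv)
    respectively. The bilateral forms of (ii) and (iv) follow by pairing r with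
    -r-1.

    For (iii), put x = q^(2n+1); then
    (1+x)/(1-x) = (1+x^3)/(1-x^3) + 2(x+x^2)/(1-x^3). The second part sums to a
    multiple of m(q,q^6,q^2). The first one is the limit n -> oo of the Bailey
    pair for q^3, hence equals J_6^3/J_{3,6}. It remains to express J_6^3/J_{3,6}
    by m(q,q^6,q^4) - m(q,q^6,q^2); this is the limit of the partial fraction
    expansion of
    x^k prod_l (1-x q^(6l)) / ((1-x q^(6l+2)) (1-x q^(6l+4))) over a finite
    window of l, evaluated at a point where the numerator cancels against half of
    the denominator. *)

(** * Limits, finite sums and series of complex numbers *)

(** The Bailey pair is verified through a recursion: b_n satisfies (1 - q^(2n+3))^2 b_(n+1) = b_n,
    and the sum over a_r obeys the same recursion because the termwise defect is a multiple of the
    unit Bailey pair, whose sum vanishes. Working with b = 1/rho_1 turns rho_1 -> oo into the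
    ordinary value b = 0, so a single limit theorem serves all four identities. Its condition is |b
    p| <= 1; (ii) and (iv) lie on the boundary. In (iii) the obstacle is a change of z in m(x,p,z),
    an identity between theta functions. It is replaced by an identity between rational functions
    followed by dominated convergence. Without the factor x^k the coefficient at pole i has size
    about q^(3i^2), largest at an end of the window; x^k, with k about half the window, moves the
    peak to the middle. The evaluation point q^(1-6n) is central as well, so folding the window
    about its middle gives terms that converge one by one. Infinite sums and products are defined by
    [iota], which says nothing without convergence; hence existence accompanies each evaluation. *)

Definition Clim (u : nat -> C) (l : C) : Prop :=
  forall eps : R, (0 < eps)%R ->
    exists N : nat, forall n : nat, (N <= n)%nat -> (Cmod (u n - l) < eps)%R.

Lemma Clim_filterlim (u : nat -> C) (l : C) :
  Clim u l <-> filterlim u eventually (@locally C_NormedModule l).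
Proof.
rewrite (filterlim_locally_ball_norm (K := C_AbsRing) (U := C_NormedModule)).
split.
- intros H eps. destruct (H eps (cond_pos eps)) as [N HN]. exists N. exact HN.
- intros H eps Heps. destruct (H (mkposreal eps Heps)) as [N HN]. exists N. exact HN.
Qed.

Lemma Clim_unique (u : nat -> C) (a b : C) : Clim u a -> Clim u b -> a = b.
Proof.
intros Ha Hb. apply Clim_filterlim in Ha. apply Clim_filterlim in Hb.
exact (filterlim_locally_unique (K := C_AbsRing) (V := C_NormedModule) u a b Ha Hb).
Qed.

Lemma Clim_ext_ev (u v : nat -> C) (l : C) (N : nat) :
  (forall n, (N <= n)%nat -> u n = v n) -> Clim u l -> Clim v l.
Proof.
intros E H eps Heps. destruct (H eps Heps) as [M HM]. exists (N + M)%nat.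
intros n Hn. rewrite <- E by lia. apply HM. lia.
Qed.

Lemma Clim_ext (u v : nat -> C) (l : C) :
  (forall n, u n = v n) -> Clim u l -> Clim v l.
Proof. intros E. apply (Clim_ext_ev u v l 0). intros n _. apply E. Qed.

Lemma Clim_const (c : C) : Clim (fun _ => c) c.
Proof.
intros eps Heps. exists 0%nat. intros n _.
replace (c - c) with (RtoC 0) by ring. rewrite Cmod_0. exact Heps.
Qed.

(** The slack [k] admits truncated subtractions: [s N = N - n] qualifies with [k = n]. *)
Lemma Clim_subseq (u : nat -> C) (l : C) (s : nat -> nat) (k : nat) :
  (forall n, (n <= s n + k)%nat) -> Clim u l -> Clim (fun n => u (s n)) l.
Proof.
intros Hs H eps Heps. destruct (H eps Heps) as [N HN]. exists (N + k)%nat.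
intros n Hn. apply HN. specialize (Hs n). lia.
Qed.

Lemma Clim_plus (u v : nat -> C) (a b : C) :
  Clim u a -> Clim v b -> Clim (fun n => u n + v n) (a + b).
Proof.
intros Hu Hv eps Heps.
destruct (Hu (eps / 2)%R ltac:(lra)) as [N HN].
destruct (Hv (eps / 2)%R ltac:(lra)) as [M HM].
exists (N + M)%nat. intros n Hn.
replace (u n + v n - (a + b)) with ((u n - a) + (v n - b)) by ring.
eapply Rle_lt_trans; [apply Cmod_triangle|].
specialize (HN n ltac:(lia)). specialize (HM n ltac:(lia)). lra.
Qed.

Lemma Clim_bounded (u : nat -> C) (l : C) :
  Clim u l -> exists N, forall n, (N <= n)%nat -> (Cmod (u n) <= Cmod l + 1)%R.
Proof.
intros H. destruct (H 1%R ltac:(lra)) as [N HN]. exists N. intros n Hn.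
specialize (HN n Hn). replace (u n) with ((u n - l) + l) by ring.
eapply Rle_trans; [apply Cmod_triangle|]. lra.
Qed.

Lemma Clim_mult (u v : nat -> C) (a b : C) :
  Clim u a -> Clim v b -> Clim (fun n => u n * v n) (a * b).
Proof.
intros Hu Hv eps Heps.
destruct (Clim_bounded u a Hu) as [K HK].
pose proof (Cmod_ge_0 a) as Pa. pose proof (Cmod_ge_0 b) as Pb.
set (A := (Cmod a + 1)%R) in *. set (B := (Cmod b + 1)%R).
assert (HA : (0 < A)%R) by (unfold A; lra). assert (HB : (0 < B)%R) by (unfold B; lra).
destruct (Hu (eps / (2 * B))%R) as [N HN]. { apply Rdiv_lt_0_compat; lra. }
destruct (Hv (eps / (2 * A))%R) as [M HM]. { apply Rdiv_lt_0_compat; lra. }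
exists (K + N + M)%nat. intros n Hn.
replace (u n * v n - a * b) with (u n * (v n - b) + (u n - a) * b) by ring.
eapply Rle_lt_trans; [apply Cmod_triangle|]. rewrite !Cmod_mult.
specialize (HK n ltac:(lia)). specialize (HN n ltac:(lia)). specialize (HM n ltac:(lia)).
assert (E1 : (Cmod (u n) * Cmod (v n - b) <= A * (eps / (2 * A)))%R).
{ apply Rmult_le_compat; try apply Cmod_ge_0; lra. }
assert (E2 : (Cmod (u n - a) * Cmod b < eps / (2 * B) * B)%R).
{ eapply Rle_lt_trans with (eps / (2 * B) * Cmod b)%R.
  - apply Rmult_le_compat_r; lra.
  - apply Rmult_lt_compat_l; [apply Rdiv_lt_0_compat; lra | unfold B; lra]. }
replace (A * (eps / (2 * A)))%R with (eps / 2)%R in E1 by (field; lra).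
replace (eps / (2 * B) * B)%R with (eps / 2)%R in E2 by (field; lra).
lra.
Qed.

Lemma Clim_scal (c : C) (u : nat -> C) (a : C) :
  Clim u a -> Clim (fun n => c * u n) (c * a).
Proof. apply Clim_mult, Clim_const. Qed.

Lemma Clim_opp (u : nat -> C) (a : C) : Clim u a -> Clim (fun n => - u n) (- a).
Proof.
intros H. replace (- a) with (- (1) * a) by ring.
apply (Clim_ext (fun n => - (1) * u n)); [intros; ring|]. now apply Clim_scal.
Qed.

Lemma Clim_inv (u : nat -> C) (a : C) :
  a <> 0 -> Clim u a -> Clim (fun n => / u n) (/ a).
Proof.
intros Ha Hu eps Heps.
assert (P : (0 < Cmod a)%R) by now apply Cmod_gt_0.
destruct (Hu (Cmod a / 2)%R ltac:(lra)) as [K HK].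
destruct (Hu (eps * (Cmod a * Cmod a / 2))%R) as [N HN].
{ apply Rmult_lt_0_compat; [lra|]. apply Rdiv_lt_0_compat; [|lra].
  now apply Rmult_lt_0_compat. }
exists (K + N)%nat. intros n Hn.
specialize (HK n ltac:(lia)). specialize (HN n ltac:(lia)).
assert (L : (Cmod a / 2 < Cmod (u n))%R).
{ pose proof (Cmod_triangle (a - u n) (u n)) as T.
  replace (a - u n + u n) with a in T by ring.
  rewrite <- (Cmod_opp (a - u n)) in T.
  replace (- (a - u n)) with (u n - a) in T by ring. lra. }
assert (Hn0 : u n <> 0). { apply Cmod_gt_0. lra. }
replace (/ u n - / a) with (- (u n - a) * (/ u n * / a)) by (field; auto).
rewrite !Cmod_mult, Cmod_opp, !Cmod_inv by assumption.
replace eps with (eps * (Cmod a * Cmod a / 2) * (/ (Cmod a / 2) * / Cmod a))%R by (field; lra).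
apply Rmult_le_0_lt_compat; try apply Cmod_ge_0; auto.
- apply Rmult_le_pos; left; apply Rinv_0_lt_compat; lra.
- apply Rmult_lt_compat_r; [apply Rinv_0_lt_compat; lra|].
  apply Rinv_lt_contravar; [|lra]. apply Rmult_lt_0_compat; lra.
Qed.

Lemma Clim_div (u v : nat -> C) (a b : C) :
  b <> 0 -> Clim u a -> Clim v b -> Clim (fun n => u n / v n) (a / b).
Proof. intros Hb Hu Hv. apply Clim_mult; [easy|]. now apply Clim_inv. Qed.

(** Half-open range, unlike [sum_n], which includes its upper index; concatenation and reversal then
    need no special case for the empty sum. *)
Fixpoint csum (f : nat -> C) (n : nat) : C :=
  match n with O => 0 | S k => csum f k + f k end.

Fixpoint cprod (f : nat -> C) (n : nat) : C :=
  match n with O => 1 | S k => cprod f k * f k end.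

Lemma csum_ext (f g : nat -> C) (n : nat) :
  (forall k, (k < n)%nat -> f k = g k) -> csum f n = csum g n.
Proof.
induction n as [|n IH]; intros H; [easy|]. simpl. rewrite IH, H; auto.
Qed.

Lemma csum_plus (f g : nat -> C) (n : nat) :
  csum (fun k => f k + g k) n = csum f n + csum g n.
Proof. induction n as [|n IH]; simpl; [ring|]. rewrite IH. ring. Qed.

Lemma csum_scal (c : C) (f : nat -> C) (n : nat) :
  csum (fun k => c * f k) n = c * csum f n.
Proof. induction n as [|n IH]; simpl; [ring|]. rewrite IH. ring. Qed.

Lemma csum_opp (f : nat -> C) (n : nat) : csum (fun k => - f k) n = - csum f n.
Proof. induction n as [|n IH]; simpl; [ring|]. rewrite IH. ring. Qed.

Lemma csum_add (f : nat -> C) (n m : nat) :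
  csum f (n + m) = csum f n + csum (fun k => f (n + k)%nat) m.
Proof.
induction m as [|m IH]; [rewrite Nat.add_0_r; simpl; ring|].
rewrite Nat.add_succ_r. simpl. rewrite IH. ring.
Qed.

Lemma csum_S_l (f : nat -> C) (n : nat) :
  csum f (S n) = f 0%nat + csum (fun k => f (S k)) n.
Proof. change (S n) with (1 + n)%nat. rewrite csum_add. simpl. ring. Qed.

Lemma csum_rev (f : nat -> C) (n : nat) :
  csum f n = csum (fun k => f (n - 1 - k)%nat) n.
Proof.
induction n as [|n IH]; [easy|].
rewrite (csum_S_l (fun k => f (S n - 1 - k)%nat)).
change (csum f (S n)) with (csum f n + f n). rewrite IH, Cplus_comm. f_equal.
- f_equal. lia.
- apply csum_ext. intros k Hk. f_equal. lia.
Qed.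

Lemma csum_triangle (f : nat -> nat -> C) (n : nat) :
  csum (fun k => csum (fun r => f r (k - r)%nat) (S k)) n =
  csum (fun r => csum (f r) (n - r)) n.
Proof.
induction n as [|n IH]; [easy|].
change (csum (fun k => csum (fun r => f r (k - r)%nat) (S k)) n
  + (csum (fun r => f r (n - r)%nat) n + f n (n - n)%nat)
  = csum (fun r => csum (f r) (S n - r)) n + csum (f n) (S n - n)).
rewrite IH, Nat.sub_diag, Nat.sub_succ_l, Nat.sub_diag by lia.
rewrite (csum_ext (fun r => csum (f r) (S n - r))
  (fun r => csum (f r) (n - r) + f r (n - r)%nat) n).
- rewrite csum_plus. simpl. ring.
- intros k Hk. replace (S n - k)%nat with (S (n - k)) by lia. easy.
Qed.

Lemma cprod_ext (f g : nat -> C) (n : nat) :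
  (forall k, (k < n)%nat -> f k = g k) -> cprod f n = cprod g n.
Proof.
induction n as [|n IH]; intros H; [easy|]. simpl. rewrite IH, H; auto.
Qed.

Lemma cprod_add (f : nat -> C) (n m : nat) :
  cprod f (n + m) = cprod f n * cprod (fun k => f (n + k)%nat) m.
Proof.
induction m as [|m IH]; [rewrite Nat.add_0_r; simpl; ring|].
rewrite Nat.add_succ_r. simpl. rewrite IH. ring.
Qed.

Lemma cprod_neq_0 (f : nat -> C) (n : nat) :
  (forall k, (k < n)%nat -> f k <> 0) -> cprod f n <> 0.
Proof.
induction n as [|n IH]; intros H; simpl; [apply C1_nz|].
apply Cmult_neq_0; auto.
Qed.

Lemma sum_n_csum (f : nat -> C) (n : nat) :
  sum_n (G := C_AbelianMonoid) f n = csum f (S n).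
Proof.
induction n as [|n IH]; [rewrite sum_O; simpl; ring|].
rewrite sum_Sn, IH. reflexivity.
Qed.

Lemma is_series_Clim (f : nat -> C) (l : C) :
  is_series (K := C_AbsRing) (V := C_NormedModule) f l <-> Clim (csum f) l.
Proof.
unfold is_series. rewrite <- Clim_filterlim. split; intros H.
- intros eps Heps. destruct (H eps Heps) as [N HN]. exists (S N).
  intros [|n] Hn; [lia|]. rewrite <- sum_n_csum. apply HN. lia.
- intros eps Heps. destruct (H eps Heps) as [N HN]. exists N.
  intros n Hn. rewrite sum_n_csum. apply HN. lia.
Qed.

Lemma CSeries_unique (f : nat -> C) (l : C) : Clim (csum f) l -> CSeries f = l.
Proof.
intros H. apply is_series_Clim in H.
exact (iota_filterlim_locally (K := C_AbsRing) (V := C_CompleteNormedModule) _ _ H).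
Qed.

Lemma CSeries_correct (f : nat -> C) : ex_series f -> Clim (csum f) (CSeries f).
Proof.
intros [l Hl]. apply is_series_Clim in Hl. now rewrite (CSeries_unique f l).
Qed.

Lemma ex_series_Clim (f : nat -> C) (l : C) : Clim (csum f) l -> ex_series f.
Proof. intros H. exists l. now apply is_series_Clim. Qed.

Lemma ex_series_geom_bound (f : nat -> C) (M r : R) :
  (0 <= r < 1)%R -> (forall n, (Cmod (f n) <= M * r ^ n)%R) -> ex_series f.
Proof.
intros Hr H.
apply (ex_series_le (K := C_AbsRing) (V := C_CompleteNormedModule) f (fun n => M * r ^ n)%R H).
apply (ex_series_scal (K := R_AbsRing) (V := R_NormedModule) M (fun n => r ^ n)%R).
apply ex_series_geom. rewrite Rabs_pos_eq; lra.
Qed.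

Lemma csum_lim_ext (f g : nat -> C) (l : C) :
  (forall n, f n = g n) -> Clim (csum f) l -> Clim (csum g) l.
Proof. intros E. apply Clim_ext. intros n. apply csum_ext. auto. Qed.

Lemma csum_lim_plus (f g : nat -> C) (a b : C) : Clim (csum f) a -> Clim (csum g) b ->
  Clim (csum (fun n => f n + g n)) (a + b).
Proof.
intros Hf Hg. apply (Clim_ext (fun n => csum f n + csum g n)).
- intros n. now rewrite csum_plus.
- now apply Clim_plus.
Qed.

Lemma csum_lim_scal (c : C) (f : nat -> C) (a : C) : Clim (csum f) a ->
  Clim (csum (fun n => c * f n)) (c * a).
Proof.
intros Hf. apply (Clim_ext (fun n => c * csum f n)).
- intros n. now rewrite csum_scal.
- now apply Clim_scal.
Qed.

Lemma CSeries_ext (f g : nat -> C) : (forall n, f n = g n) -> ex_series g -> CSeries f = CSeries g.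
Proof.
intros E H. apply CSeries_unique, (csum_lim_ext g); [auto | now apply CSeries_correct].
Qed.

Lemma CSeries_plus (f g : nat -> C) : ex_series f -> ex_series g ->
  CSeries (fun n => f n + g n) = CSeries f + CSeries g.
Proof. intros Hf Hg. apply CSeries_unique, csum_lim_plus; now apply CSeries_correct. Qed.

Lemma CSeries_scal (c : C) (f : nat -> C) : ex_series f ->
  CSeries (fun n => c * f n) = c * CSeries f.
Proof. intros Hf. now apply CSeries_unique, csum_lim_scal, CSeries_correct. Qed.

Lemma Cmod_csum_le (f : nat -> C) (M r : R) (n : nat) : (0 <= r < 1)%R ->
  (forall k, (k < n)%nat -> (Cmod (f k) <= M * r ^ k)%R) ->
  (Cmod (csum f n) <= M * ((1 - r ^ n) / (1 - r)))%R.
Proof.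
intros Hr. induction n as [|n IH]; intros H.
- simpl. rewrite Cmod_0. right. field. lra.
- simpl csum. eapply Rle_trans; [apply Cmod_triangle|].
  specialize (IH (fun k Hk => H k ltac:(lia))). specialize (H n ltac:(lia)).
  replace (M * ((1 - r ^ S n) / (1 - r)))%R
    with (M * ((1 - r ^ n) / (1 - r)) + M * r ^ n)%R by (simpl; field; lra).
  lra.
Qed.

(** Tannery's theorem with a geometric majorant, for sums whose length grows with the parameter. It
    carries every passage from a finite identity to an infinite one below. *)
Lemma Clim_tannery (f : nat -> nat -> C) (l : nat -> C) (M r : R) :
  (0 <= r < 1)%R ->
  (forall N n, (n <= N)%nat -> (Cmod (f N n) <= M * r ^ n)%R) ->
  (forall n, Clim (fun N => f N n) (l n)) ->
  (forall n, (Cmod (l n) <= M * r ^ n)%R) ->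
  Clim (fun N => csum (f N) (S N)) (CSeries l).
Proof.
intros Hr Hf Hl Bl eps Heps.
assert (M0 : (0 <= M)%R).
{ specialize (Bl 0%nat). simpl in Bl. pose proof (Cmod_ge_0 (l 0%nat)). lra. }
assert (S0 := CSeries_correct l (ex_series_geom_bound l M r Hr Bl)).
destruct (S0 (eps / 4)%R ltac:(lra)) as [N1 H1].
assert (T : exists K, forall k, (K <= k)%nat -> (M / (1 - r) * r ^ k < eps / 4)%R).
{ assert (D : (0 < M / (1 - r) + 1)%R).
  { assert (0 <= M / (1 - r))%R by (apply Rmult_le_pos; [lra|]; left; apply Rinv_0_lt_compat; lra). lra. }
  destruct (pow_lt_1_zero r ltac:(rewrite Rabs_pos_eq; lra) (eps / 4 / (M / (1 - r) + 1))%R) as [K HK].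
  { apply Rdiv_lt_0_compat; lra. }
  exists K. intros k Hk. specialize (HK k Hk).
  assert (P := pow_le r k (proj1 Hr)). rewrite Rabs_pos_eq in HK by assumption.
  apply (Rmult_lt_compat_l _ _ _ D) in HK.
  replace ((M / (1 - r) + 1) * (eps / 4 / (M / (1 - r) + 1)))%R with (eps / 4)%R in HK
    by (field; split; lra).
  nra. }
(* Beyond [L] the tail of the limit series and, uniformly in [N], the tails of the finite sums are
   below eps/4; only the first [L] terms use the pointwise limits. *)
destruct T as [K HK]. set (L := (N1 + K)%nat).
assert (F : Clim (fun N => csum (f N) L) (csum l L)).
{ generalize L. intros k. induction k as [|k IH]; simpl; [apply Clim_const|].
  now apply Clim_plus. }
destruct (F (eps / 4)%R ltac:(lra)) as [N2 H2].
exists (L + N2)%nat. intros N HN.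
replace (S N) with (L + (S N - L))%nat by lia. rewrite csum_add.
replace (csum (f N) L + csum (fun k => f N (L + k)%nat) (S N - L) - CSeries l)
  with ((csum (f N) L - csum l L) + ((csum l L - CSeries l) + csum (fun k => f N (L + k)%nat) (S N - L)))
  by ring.
eapply Rle_lt_trans; [apply Cmod_triangle|].
assert (A := H2 N ltac:(lia)). assert (B := H1 L ltac:(lia)).
assert (D := Cmod_triangle (csum l L - CSeries l) (csum (fun k => f N (L + k)%nat) (S N - L))).
assert (E : (Cmod (csum (fun k => f N (L + k)%nat) (S N - L)) < eps / 4)%R).
{ eapply Rle_lt_trans; [apply (Cmod_csum_le _ (M * r ^ L) r _ Hr)|].
  - intros k Hk. eapply Rle_trans; [apply Hf; lia|]. rewrite pow_add. right. ring.
  - eapply Rle_lt_trans; [|apply (HK L); lia].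
    assert (P := pow_le r L (proj1 Hr)). assert (P' := pow_le r (S N - L) (proj1 Hr)).
    replace (M / (1 - r) * r ^ L)%R with (M * r ^ L * (1 / (1 - r)))%R by (field; lra).
    apply Rmult_le_compat_l; [now apply Rmult_le_pos|].
    apply Rmult_le_compat_r; [left; apply Rinv_0_lt_compat|]; lra. }
lra.
Qed.

(** * q-Pochhammer symbols *)

Lemma Clim_bounded_all (u : nat -> C) (l : C) :
  Clim u l -> exists M, (0 <= M)%R /\ forall n, (Cmod (u n) <= M)%R.
Proof.
intros H. destruct (Clim_bounded u l H) as [N HN].
assert (F : exists A, (0 <= A)%R /\ forall n, (n < N)%nat -> (Cmod (u n) <= A)%R).
{ clear. induction N as [|N [A [HA IH]]].
  - exists 0%R. split; [lra | intros; lia].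
  - exists (Rmax A (Cmod (u N))). split; [eapply Rle_trans; [exact HA | apply Rmax_l]|].
    intros n Hn. destruct (Nat.eq_dec n N) as [->|]; [apply Rmax_r|].
    eapply Rle_trans; [apply IH; lia | apply Rmax_l]. }
destruct F as [A [HA F]]. exists (A + (Cmod l + 1))%R. pose proof (Cmod_ge_0 l).
split; [lra|]. intros n. destruct (Nat.lt_ge_cases n N) as [h|h].
- specialize (F n h). lra.
- specialize (HN n h). lra.
Qed.

(** From 1 + t <= exp t, with the exponents summed as a geometric series. *)
Lemma cprod_bounded (f : nat -> C) (B r : R) : (0 <= r < 1)%R -> (0 <= B)%R ->
  (forall k, (Cmod (f k) <= 1 + B * r ^ k)%R) ->
  forall n, (Cmod (cprod f n) <= exp (B / (1 - r)))%R.
Proof.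
intros Hr HB H n.
assert (E : (Cmod (cprod f n) <= exp (B * ((1 - r ^ n) / (1 - r))))%R).
{ induction n as [|n IH].
  - simpl. rewrite Cmod_1. replace (B * ((1 - 1) / (1 - r)))%R with 0%R by (field; lra).
    rewrite exp_0. lra.
  - simpl cprod. rewrite Cmod_mult.
    replace (B * ((1 - r ^ S n) / (1 - r)))%R
      with (B * ((1 - r ^ n) / (1 - r)) + B * r ^ n)%R by (simpl; field; lra).
    rewrite exp_plus. apply Rmult_le_compat; try apply Cmod_ge_0; auto.
    eapply Rle_trans; [apply H|]. apply exp_ineq1_le. }
eapply Rle_trans; [exact E|].
assert (L : (B * ((1 - r ^ n) / (1 - r)) <= B / (1 - r))%R).
{ unfold Rdiv. rewrite <- Rmult_assoc. apply Rmult_le_compat_r.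
  - left. apply Rinv_0_lt_compat. lra.
  - pose proof (pow_le r n (proj1 Hr)). nra. }
destruct L as [L|L]; [left; now apply exp_increasing | rewrite L; lra].
Qed.

Lemma cprod_inv (f : nat -> C) (n : nat) : (forall k, (k < n)%nat -> f k <> 0) ->
  cprod (fun k => / f k) n = / cprod f n.
Proof.
induction n as [|n IH]; intros H; simpl.
- field.
- rewrite IH by auto. field. split; [apply H; lia|]. apply cprod_neq_0. auto.
Qed.

Lemma qpoch_cprod (x p : C) (n : nat) : qpoch x p n = cprod (fun k => 1 - x * p ^ k) n.
Proof. induction n as [|n IH]; simpl; [easy | now rewrite IH]. Qed.

Lemma qpoch_add (x p : C) (n m : nat) :
  qpoch x p (n + m) = qpoch x p n * qpoch (x * p ^ n) p m.
Proof.
rewrite !qpoch_cprod, cprod_add. f_equal. apply cprod_ext. intros k _.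
rewrite Cpow_add_r. ring.
Qed.

Lemma qpoch_S_l (x p : C) (n : nat) : qpoch x p (S n) = (1 - x) * qpoch (x * p) p n.
Proof.
change (S n) with (1 + n)%nat. rewrite qpoch_add. simpl.
f_equal; [ring | f_equal; ring].
Qed.

Lemma qpoch_neq_0 (x p : C) (n : nat) :
  (forall k, (k < n)%nat -> 1 - x * p ^ k <> 0) -> qpoch x p n <> 0.
Proof. rewrite qpoch_cprod. apply cprod_neq_0. Qed.

Lemma Clim_pow_0 (p : C) : (Cmod p < 1)%R -> Clim (fun n => p ^ n) 0.
Proof.
intros Hp eps Heps. pose proof (Cmod_ge_0 p).
destruct (pow_lt_1_zero (Cmod p) ltac:(rewrite Rabs_pos_eq; lra) eps Heps) as [N HN].
exists N. intros n Hn. replace (p ^ n - 0) with (p ^ n) by ring.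
rewrite Cmod_pow. eapply Rle_lt_trans; [apply Rle_abs | now apply HN].
Qed.

Lemma qpoch_bounded (x p : C) : (Cmod p < 1)%R ->
  exists M, (0 <= M)%R /\ forall n, (Cmod (qpoch x p n) <= M)%R.
Proof.
intros Hp. exists (exp (Cmod x / (1 - Cmod p))). split; [left; apply exp_pos|].
intros n. rewrite qpoch_cprod. apply cprod_bounded.
- split; [apply Cmod_ge_0 | exact Hp].
- apply Cmod_ge_0.
- intros k. eapply Rle_trans; [apply Cmod_triangle|].
  rewrite Cmod_1, Cmod_opp, Cmod_mult, Cmod_pow. lra.
Qed.

(** The increments (x;p)_(n+1) - (x;p)_n = -(x;p)_n x p^n form a geometrically dominated series, so
    the products converge as its partial sums. *)
Lemma qpoch_inf_lim (x p : C) : (Cmod p < 1)%R -> Clim (qpoch x p) (qpoch_inf x p).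
Proof.
intros Hp. destruct (qpoch_bounded x p Hp) as [M [HM B]].
assert (E : ex_series (fun n => - (qpoch x p n * x * p ^ n))).
{ apply (ex_series_geom_bound _ (M * Cmod x) (Cmod p)).
  - split; [apply Cmod_ge_0 | exact Hp].
  - intros n. rewrite Cmod_opp, !Cmod_mult, Cmod_pow.
    apply Rmult_le_compat_r; [apply pow_le, Cmod_ge_0|].
    apply Rmult_le_compat_r; [apply Cmod_ge_0 | apply B]. }
apply CSeries_correct in E.
assert (L : Clim (qpoch x p) (1 + CSeries (fun n => - (qpoch x p n * x * p ^ n)))).
{ eapply Clim_ext; [|apply (Clim_plus _ _ _ _ (Clim_const 1) E)].
  intros n. cbv beta. induction n as [|n IH]; simpl; [ring|]. rewrite <- IH at 2. rewrite <- IH. ring. }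
replace (qpoch_inf x p) with (1 + CSeries (fun n => - (qpoch x p n * x * p ^ n))); [exact L|].
symmetry. apply Clim_filterlim in L.
exact (iota_filterlim_locally (K := C_AbsRing) (V := C_CompleteNormedModule) _ _ L).
Qed.

(** Each inverse factor is 1 + x p^k / (1 - x p^k), and 1/(1 - x p^k) is bounded because it tends to
    1; [cprod_bounded] then applies again. *)
Lemma qpoch_inv_bounded (x p : C) : (Cmod p < 1)%R ->
  (forall k, 1 - x * p ^ k <> 0) ->
  exists M, (0 <= M)%R /\ forall n, (Cmod (/ qpoch x p n) <= M)%R.
Proof.
intros Hp Hx.
assert (L : Clim (fun k => / (1 - x * p ^ k)) (/ 1)).
{ apply Clim_inv; [apply C1_nz|].
  assert (L := Clim_plus _ _ _ _ (Clim_const 1) (Clim_scal (- x) _ _ (Clim_pow_0 p Hp))).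
  replace (1 + - x * 0) with (RtoC 1) in L by ring.
  eapply Clim_ext; [|exact L]. intros k. cbv beta. ring. }
destruct (Clim_bounded_all _ _ L) as [K [HK BK]].
exists (exp (K * Cmod x / (1 - Cmod p))). split; [left; apply exp_pos|].
intros n. rewrite qpoch_cprod, <- cprod_inv by auto. apply cprod_bounded.
- split; [apply Cmod_ge_0 | exact Hp].
- apply Rmult_le_pos; [exact HK | apply Cmod_ge_0].
- intros k. replace (/ (1 - x * p ^ k)) with (1 + / (1 - x * p ^ k) * (x * p ^ k))
    by (field; apply Hx).
  eapply Rle_trans; [apply Cmod_triangle|].
  rewrite Cmod_1, !Cmod_mult, Cmod_pow. apply Rplus_le_compat_l.
  rewrite <- Rmult_assoc. repeat apply Rmult_le_compat_r;
    [apply pow_le, Cmod_ge_0 | apply Cmod_ge_0 | apply BK].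
Qed.

(** A zero limit would make the reciprocals of the partial products unbounded. *)
Lemma qpoch_inf_neq_0 (x p : C) : (Cmod p < 1)%R ->
  (forall k, 1 - x * p ^ k <> 0) -> qpoch_inf x p <> 0.
Proof.
intros Hp Hx E. pose proof (qpoch_inf_lim x p Hp) as L. rewrite E in L.
destruct (qpoch_inv_bounded x p Hp Hx) as [M [HM B]].
destruct (L (/ (M + 1))%R) as [N HN]; [apply Rinv_0_lt_compat; lra|].
specialize (HN N (le_n N)). specialize (B N).
replace (qpoch x p N - 0) with (qpoch x p N) in HN by ring.
assert (Z : qpoch x p N <> 0) by (apply qpoch_neq_0; auto).
rewrite Cmod_inv in B by exact Z. apply Cmod_gt_0 in Z.
apply Rinv_lt_contravar in HN.
- rewrite Rinv_inv in HN. lra.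
- apply Rmult_lt_0_compat; [exact Z | apply Rinv_0_lt_compat; lra].
Qed.

Lemma Cmod_pow_lt_1 (q : C) (n : nat) : (Cmod q < 1)%R -> (0 < n)%nat -> (Cmod (q ^ n) < 1)%R.
Proof.
intros H Hn. rewrite Cmod_pow. apply pow_lt_1_compat; [split; [apply Cmod_ge_0 | exact H] | exact Hn].
Qed.

Lemma one_minus_neq_0 (x : C) : (Cmod x < 1)%R -> 1 - x <> 0.
Proof.
intros H E. assert (X : x = 1) by (replace x with (1 - (1 - x)) by ring; rewrite E; ring).
rewrite X, Cmod_1 in H. lra.
Qed.

Lemma qpoch_factor_neq_0 (x p : C) : (Cmod x < 1)%R -> (Cmod p < 1)%R ->
  forall k, 1 - x * p ^ k <> 0.
Proof.
intros Hx Hp k. apply one_minus_neq_0. rewrite Cmod_mult, Cmod_pow.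
assert (H := pow_incr (Cmod p) 1 k ltac:(split; [apply Cmod_ge_0 | lra])). rewrite pow1 in H.
pose proof (Cmod_ge_0 x). pose proof (pow_le _ k (Cmod_ge_0 p)). nra.
Qed.

(** * q-Chu-Vandermonde and Bailey's lemma *)

(** The Gaussian binomial coefficient, given by its Pascal recursion: no division is involved, it
    vanishes for m > N, and it fits the induction proving q-Chu-Vandermonde. *)
Fixpoint qbinom (p : C) (N m : nat) : C :=
  match N, m with
  | _, O => 1
  | O, S _ => 0
  | S N', S m' => p ^ m * qbinom p N' m + qbinom p N' m'
  end.

Lemma qbinom_gt (p : C) (N m : nat) : (N < m)%nat -> qbinom p N m = 0.
Proof.
revert m. induction N as [|N IH]; intros [|m] H; try lia; [easy|].
cbn [qbinom]. rewrite !IH by lia. ring.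
Qed.

Lemma qbinom_0 (p : C) (N : nat) : qbinom p N 0 = 1.
Proof. now destruct N. Qed.

Lemma qbinom_diag (p : C) (N : nat) : qbinom p N N = 1.
Proof.
induction N as [|N IH]; [easy|]. cbn [qbinom]. rewrite IH, qbinom_gt by lia. ring.
Qed.

Lemma qbinom_qpoch (p : C) (m k : nat) :
  qbinom p (m + k) m * (qpoch p p m * qpoch p p k) = qpoch p p (m + k).
Proof.
remember (m + k)%nat as N eqn:E. revert m k E.
induction N as [|N IH]; intros [|m] [|k] E; try lia.
- simpl. ring.
- replace k with N by lia. rewrite qbinom_0. cbn [qpoch]. ring.
- replace m with N by lia. rewrite qbinom_diag. cbn [qpoch]. ring.
- cbn [qbinom].
  assert (A := IH (S m) k ltac:(lia)). assert (B := IH m (S k) ltac:(lia)).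
  cbn [qpoch] in *. replace N with (S m + k)%nat at 4 by lia.
  rewrite !Cpow_add_r, !Cpow_S.
  transitivity (p * p ^ m * (1 - p * p ^ k) * qpoch p p N + (1 - p * p ^ m) * qpoch p p N).
  + rewrite <- A at 1. rewrite <- B. ring.
  + ring.
Qed.

(* [qvand_term p c y m] equals
   (-y)^m (c/y;p)_m p^(m(m-1)/2) / (c;p)_m. *)
Definition qvand_term (p c y : C) (m : nat) : C :=
  cprod (fun k => (c * p ^ k - y) * p ^ k) m / qpoch c p m.

(** The contiguity relation behind the induction step: the two neighbours produced by Pascal's rule
    merge into one term with both parameters multiplied by p. *)
Lemma qvand_term_shift (p c y : C) (m : nat) : (forall k, 1 - c * p ^ k <> 0) ->
  p ^ m * qvand_term p c y m + qvand_term p c y (S m) =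
  (1 - y) / (1 - c) * qvand_term p (c * p) (y * p) m.
Proof.
intros H. unfold qvand_term.
assert (H0 : 1 - c <> 0) by (specialize (H 0%nat); simpl in H; now rewrite Cmult_1_r in H).
assert (Hm : qpoch c p m <> 0) by (apply qpoch_neq_0; auto).
assert (Hm' : qpoch (c * p) p m <> 0).
{ apply qpoch_neq_0. intros k _. specialize (H (S k)). rewrite Cpow_S in H.
  now replace (c * p * p ^ k) with (c * (p * p ^ k)) by ring. }
assert (E := qpoch_S_l c p m). cbn [qpoch] in E.
replace (cprod (fun k => (c * p * p ^ k - y * p) * p ^ k) m)
  with (p ^ m * cprod (fun k => (c * p ^ k - y) * p ^ k) m).
2: { clear. induction m as [|m IH]; cbn [cprod]; [simpl; ring|]. rewrite <- IH, Cpow_S. ring. }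
replace (qpoch (c * p) p m) with (qpoch c p m * (1 - c * p ^ m) / (1 - c))
  by (rewrite E; field; auto).
cbn [cprod qpoch]. field. auto.
Qed.

(** Pascal's rule splits the sum; after reindexing, the two parts combine by [qvand_term_shift] into
    the sum at level N for (c p, y p), so the induction must quantify over c and y. Since the terms
    contain no division by y, the value y = 0 is allowed, as required when b = 0. *)
Lemma q_vandermonde (p c y : C) (N : nat) : (forall k, 1 - c * p ^ k <> 0) ->
  csum (fun m => qbinom p N m * qvand_term p c y m) (S N) = qpoch y p N / qpoch c p N.
Proof.
revert c y. induction N as [|N IH]; intros c y H.
{ unfold qvand_term. simpl. field. }
assert (H' : forall k, 1 - c * p * p ^ k <> 0).
{ intros k. specialize (H (S k)). rewrite Cpow_S in H.
  now replace (c * p * p ^ k) with (c * (p * p ^ k)) by ring. }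
assert (H0 : 1 - c <> 0) by (specialize (H 0%nat); simpl in H; now rewrite Cmult_1_r in H).
rewrite csum_S_l, qbinom_0.
rewrite (csum_ext _ (fun m => p ^ S m * qbinom p N (S m) * qvand_term p c y (S m)
  + qbinom p N m * qvand_term p c y (S m))) by (intros; cbn [qbinom]; ring).
rewrite csum_plus, Cplus_assoc.
assert (E : 1 * qvand_term p c y 0
  + csum (fun m => p ^ S m * qbinom p N (S m) * qvand_term p c y (S m)) (S N)
  = csum (fun m => p ^ m * qbinom p N m * qvand_term p c y m) (S N)).
{ rewrite (csum_S_l (fun m => p ^ m * qbinom p N m * qvand_term p c y m) N), qbinom_0.
  cbn [csum]. rewrite qbinom_gt by lia. simpl (p ^ 0). ring. }
rewrite E, <- csum_plus.
rewrite (csum_ext _ (fun m => (1 - y) / (1 - c)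
   * (qbinom p N m * qvand_term p (c * p) (y * p) m))).
- rewrite csum_scal, IH, !qpoch_S_l by exact H'. field. split; [|exact H0].
  apply qpoch_neq_0. auto.
- intros m _.
  transitivity (qbinom p N m * (p ^ m * qvand_term p c y m + qvand_term p c y (S m))); [ring|].
  rewrite qvand_term_shift by exact H. ring.
Qed.

Lemma Cpow_mult_2 (x : C) (n : nat) : x ^ (2 * n) = x ^ n * x ^ n.
Proof. rewrite <- Cpow_add_r. f_equal. lia. Qed.

(* [bailey_delta p b n] is the limit case rho_2 -> oo, with rho_1 = 1/b, of
   (rho_1)_n (rho_2)_n (p^2/(rho_1 rho_2))^n; putting b = 0 also sends rho_1 to
   infinity. *)
Definition bailey_delta (p b : C) (n : nat) : C :=
  cprod (fun k => (p ^ k - b) * p ^ (k + 2)) n.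

(** The inner sum of Bailey's lemma. Multiplying by (p;p)_N turns 1/((p;p)_m (p;p)_(N-m)) into a
    Gaussian binomial, and what remains is q-Chu-Vandermonde with c = p^(2r+2) and y = p^(r+2) b. *)
Lemma bailey_delta_sum (p b : C) (r N : nat) : (Cmod p < 1)%R ->
  csum (fun m => bailey_delta p b (r + m)
    / (qpoch p p m * qpoch p p (2 * r + 1 + m) * qpoch p p (N - m))) (S N) =
  bailey_delta p b r * qpoch (p ^ (r + 2) * b) p N
    / (qpoch p p N * qpoch p p (2 * r + 1 + N)).
Proof.
intros Hp.
assert (Hpp : forall n, qpoch p p n <> 0)
  by (intros n; apply qpoch_neq_0; intros; now apply qpoch_factor_neq_0).
set (c := p ^ (2 * r + 2)).
assert (Hc : forall k, 1 - c * p ^ k <> 0).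
{ apply qpoch_factor_neq_0; [apply Cmod_pow_lt_1; [exact Hp | lia] | exact Hp]. }
assert (Hcn : forall n, qpoch c p n <> 0) by (intros; apply qpoch_neq_0; auto).
assert (Hs : forall m, qpoch p p (2 * r + 1 + m) = qpoch p p (2 * r + 1) * qpoch c p m).
{ intros m. rewrite qpoch_add. do 2 f_equal. unfold c. rewrite <- Cpow_S. f_equal. lia. }
rewrite (csum_ext _ (fun m => bailey_delta p b r / (qpoch p p (2 * r + 1) * qpoch p p N)
   * (qbinom p N m * qvand_term p c (p ^ (r + 2) * b) m))).
- rewrite csum_scal, q_vandermonde by exact Hc. rewrite Hs. field. auto.
- intros m Hm. assert (E := qbinom_qpoch p m (N - m)).
  replace (m + (N - m))%nat with N in E by lia.
  rewrite Hs, <- E. unfold qvand_term, bailey_delta. rewrite cprod_add.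
  rewrite (cprod_ext (fun k => (p ^ (r + k) - b) * p ^ (r + k + 2))
    (fun k => (c * p ^ k - p ^ (r + 2) * b) * p ^ k)).
  + field. repeat split; auto. intros Z. apply (Hpp N). rewrite <- E, Z. ring.
  + intros k _. unfold c. rewrite !Cpow_add_r, Cpow_mult_2. ring.
Qed.

(* Bailey's lemma at level [N], relative to a = p, with
   (p^2;p)_(n+r) rewritten as (p;p)_(n+r+1) / (1 - p). *)
Lemma bailey_finite (p b : C) (alpha beta : nat -> C) (N : nat) : (Cmod p < 1)%R ->
  (forall n, beta n =
     csum (fun r => alpha r / (qpoch p p (n - r) * qpoch p p (n + r + 1))) (S n)) ->
  csum (fun n => bailey_delta p b n * beta n / qpoch p p (N - n)) (S N) =
  csum (fun r => alpha r * bailey_delta p b r * qpoch (p ^ (r + 2) * b) p (N - r)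
    / (qpoch p p (N - r) * qpoch p p (N + r + 1))) (S N).
Proof.
intros Hp H.
assert (Hpp : forall n, qpoch p p n <> 0)
  by (intros n; apply qpoch_neq_0; intros; now apply qpoch_factor_neq_0).
(* [f r m] is the contribution of [alpha r] to the index n = r + m. Exchanging the triangular sum
   leaves an inner sum over m, evaluated by [bailey_delta_sum]. *)
set (f := fun r m => alpha r * (bailey_delta p b (r + m)
    / (qpoch p p m * qpoch p p (2 * r + 1 + m) * qpoch p p (N - r - m)))).
rewrite (csum_ext _ (fun n => csum (fun r => f r (n - r)%nat) (S n))).
- rewrite csum_triangle. apply csum_ext. intros r Hr. unfold f.
  rewrite csum_scal. replace (S N - r)%nat with (S (N - r)) by lia.
  rewrite bailey_delta_sum by exact Hp.
  replace (2 * r + 1 + (N - r))%nat with (N + r + 1)%nat by lia. field. auto.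
- intros n Hn. rewrite H.
  transitivity (bailey_delta p b n / qpoch p p (N - n)
    * csum (fun r => alpha r / (qpoch p p (n - r) * qpoch p p (n + r + 1))) (S n)).
  { field. auto. }
  rewrite <- csum_scal. apply csum_ext. intros r Hr. unfold f.
  replace (r + (n - r))%nat with n by lia.
  replace (2 * r + 1 + (n - r))%nat with (n + r + 1)%nat by lia.
  replace (N - r - (n - r))%nat with (N - n)%nat by lia. field. auto.
Qed.

(** * The Bailey pair *)

Lemma Cmult_cancel_l (a x y : C) : a <> 0 -> a * x = a * y -> x = y.
Proof.
intros Ha E. replace x with (/ a * (a * x)) by (field; exact Ha). rewrite E. field. exact Ha.
Qed.

Definition bailey_alpha (q : C) (r : nat) : C :=
  (- (1)) ^ r * q ^ (r * (r + 1)) * (1 + q ^ (2 * r + 1)) / (1 - q ^ (2 * r + 1)).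

(* The unit Bailey pair: for [k <= N] the partial sums telescope. *)
Lemma unit_bailey_partial (q : C) (N k : nat) : (Cmod q < 1)%R -> (k <= N)%nat ->
  let p := q ^ 2 in
  (1 - p ^ N) * csum (fun r => (- (1)) ^ r * q ^ (r * (r - 1)) * (1 - p ^ (2 * r + 1))
    / (qpoch p p (N - r) * qpoch p p (N + r + 1))) k =
  - ((- (1)) ^ k * q ^ (k * (k - 1)) * (1 - p ^ k)
      / (qpoch p p (N - k) * qpoch p p (N + k))).
Proof.
intros Hq HkN p.
assert (Hp : (Cmod p < 1)%R) by (apply Cmod_pow_lt_1; [exact Hq | lia]).
assert (Hpp : forall n, qpoch p p n <> 0)
  by (intros n; apply qpoch_neq_0; intros; now apply qpoch_factor_neq_0).
assert (Hf := qpoch_factor_neq_0 p p Hp Hp).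
induction k as [|k IH].
- cbn [csum]. simpl (p ^ 0). unfold Cdiv. ring.
- cbn [csum]. rewrite Cmult_plus_distr_l, IH by lia.
  replace (S k * (S k - 1))%nat with (k * (k - 1) + 2 * k)%nat by nia.
  replace (N - k)%nat with (S (N - S k)) by lia.
  replace (N + S k)%nat with (S (N + k)) by lia.
  replace (N + k + 1)%nat with (S (N + k)) by lia.
  assert (A := Hf (N - S k)%nat). assert (B := Hf (N + k)%nat).
  assert (A' := Hpp (N - S k)%nat). assert (B' := Hpp (N + k)%nat).
  cbn [qpoch] in *.
  assert (E : p ^ N = p * p ^ (N - S k) * p ^ k).
  { rewrite <- Cpow_S, <- Cpow_add_r. f_equal. lia. }
  rewrite !Cpow_add_r, !Cpow_mult_2, !Cpow_S, E in *.
  replace (q ^ k * q ^ k) with (p ^ k)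
    by (unfold p; rewrite <- Cpow_mult_r; apply Cpow_mult_2).
  field. repeat split; auto.
Qed.

(** The term r = N cancels the telescoped value of the terms before it. Positivity of N makes the
    multiplier 1 - p^N nonzero. *)
Lemma unit_bailey (q : C) (N : nat) : (Cmod q < 1)%R -> (0 < N)%nat ->
  let p := q ^ 2 in
  csum (fun r => (- (1)) ^ r * q ^ (r * (r - 1)) * (1 - p ^ (2 * r + 1))
    / (qpoch p p (N - r) * qpoch p p (N + r + 1))) (S N) = 0.
Proof.
intros Hq HN p.
assert (Hp : (Cmod p < 1)%R) by (apply Cmod_pow_lt_1; [exact Hq | lia]).
assert (Hpp : forall n, qpoch p p n <> 0)
  by (intros n; apply qpoch_neq_0; intros; now apply qpoch_factor_neq_0).
assert (Hf := qpoch_factor_neq_0 p p Hp Hp).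
assert (H0 : 1 - p ^ N <> 0) by (apply one_minus_neq_0, Cmod_pow_lt_1; auto).
assert (E := unit_bailey_partial q N N Hq (le_n N)). cbv zeta in E. fold p in E.
apply (Cmult_cancel_l (1 - p ^ N)); [exact H0|]. cbn [csum].
rewrite Cmult_plus_distr_l, E, Nat.sub_diag.
replace (N + N + 1)%nat with (S (N + N)) by lia.
replace (2 * N + 1)%nat with (S (N + N)) by lia.
cbn [qpoch]. rewrite Cpow_S. field. repeat split; auto.
Qed.

(** Compared term by term, the two sides differ by p^(n+1) times the summand of the unit Bailey pair
    at level n + 1, and those summands add up to zero. *)
Lemma bailey_pair_rec (q : C) (n : nat) : (Cmod q < 1)%R ->
  let p := q ^ 2 in
  let s n := csum (fun r => bailey_alpha q r / (qpoch p p (n - r) * qpoch p p (n + r + 1))) (S n) in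
  (1 - q * p ^ S n) ^ 2 * s (S n) = s n.
Proof.
intros Hq p s.
assert (Hp : (Cmod p < 1)%R) by (apply Cmod_pow_lt_1; [exact Hq | lia]).
assert (Hpp : forall n, qpoch p p n <> 0)
  by (intros k; apply qpoch_neq_0; intros; now apply qpoch_factor_neq_0).
assert (Hf := qpoch_factor_neq_0 p p Hp Hp).
assert (Hq' := qpoch_factor_neq_0 q p Hq Hp).
assert (X : forall r, q ^ (2 * r + 1) = q * p ^ r).
{ intros r. rewrite Cpow_add_r, Cpow_mult_r. unfold p. ring. }
assert (Y : forall r, q ^ (r * (r + 1)) = q ^ (r * (r - 1)) * p ^ r).
{ intros r. unfold p. rewrite <- Cpow_mult_r, <- Cpow_add_r. f_equal. nia. }
set (F := fun r => (- (1)) ^ r * q ^ (r * (r - 1)) * (1 - p ^ (2 * r + 1))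
    / (qpoch p p (S n - r) * qpoch p p (S n + r + 1))).
assert (Z : csum F (S (S n)) = 0) by (apply (unit_bailey q (S n) Hq); lia).
set (t := fun n r => bailey_alpha q r / (qpoch p p (n - r) * qpoch p p (n + r + 1))).
assert (Epq : p = q * q) by (unfold p; ring). clearbody p.
(* The top index r = n + 1 has no counterpart in [s n], so here the defect is the entire term. *)
assert (E1 : (1 - q * p ^ S n) ^ 2 * t (S n) (S n) = p ^ S n * F (S n)).
{ unfold t, F, bailey_alpha. assert (A := Hpp (S n + S n + 1)%nat).
  rewrite Nat.sub_diag, X, Y. specialize (Hq' (S n)). set (N := S n) in *. cbn [qpoch].
  rewrite (Cpow_add_r p (2 * N) 1), Cpow_mult_2, Cpow_1_r.
  subst p. field. auto. }
assert (E2 : forall r, (r <= n)%nat ->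
  (1 - q * p ^ S n) ^ 2 * t (S n) r = t n r + p ^ S n * F r).
{ intros r Hr. unfold t, F, bailey_alpha. rewrite X, Y.
  replace (S n - r)%nat with (S (n - r)) by lia.
  replace (S n + r + 1)%nat with (S (n + r + 1)) by lia.
  specialize (Hq' r). assert (A := Hf (n - r)%nat). assert (B := Hf (n + r + 1)%nat).
  assert (A' := Hpp (n - r)%nat). assert (B' := Hpp (n + r + 1)%nat).
  cbn [qpoch].
  assert (E : p ^ S n = p * p ^ (n - r) * p ^ r)
    by (rewrite <- Cpow_S, <- Cpow_add_r; f_equal; lia).
  assert (E' : p ^ (n + r + 1) = p * p ^ (n - r) * p ^ r * p ^ r)
    by (rewrite <- Cpow_S, <- !Cpow_add_r; f_equal; lia).
  rewrite E' in *. rewrite E.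
  rewrite (Cpow_add_r p (2 * r) 1), Cpow_mult_2, Cpow_1_r.
  subst p. field. auto. }
transitivity ((1 - q * p ^ S n) ^ 2 * csum (t (S n)) (S (S n))); [easy|].
change (csum (t (S n)) (S (S n))) with (csum (t (S n)) (S n) + t (S n) (S n)).
rewrite Cmult_plus_distr_l, E1, <- csum_scal.
rewrite (csum_ext _ (fun r => t n r + p ^ S n * F r)) by (intros; apply E2; lia).
rewrite csum_plus, csum_scal, <- Cplus_assoc, <- Cmult_plus_distr_l.
change (csum F (S n) + F (S n)) with (csum F (S (S n))). rewrite Z.
unfold s. fold (t n). ring.
Qed.

Lemma bailey_pair (q : C) (n : nat) : (Cmod q < 1)%R ->
  let p := q ^ 2 in
  / qpoch q p (n + 1) ^ 2 =
  csum (fun r => bailey_alpha q r / (qpoch p p (n - r) * qpoch p p (n + r + 1))) (S n).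
Proof.
intros Hq p.
assert (Hp : (Cmod p < 1)%R) by (apply Cmod_pow_lt_1; [exact Hq | lia]).
assert (Hf := qpoch_factor_neq_0 q p Hq Hp).
assert (Hqp : forall n, qpoch q p n <> 0) by (intros; apply qpoch_neq_0; auto).
induction n as [|n IH].
- assert (H1 := one_minus_neq_0 q Hq). assert (H2 := one_minus_neq_0 p Hp).
  unfold bailey_alpha. simpl. unfold p in *.  field.
  repeat split; auto.
- assert (E := bailey_pair_rec q n Hq). cbv beta zeta in E. fold p in E.
  rewrite <- IH in E.
  apply (Cmult_cancel_l ((1 - q * p ^ S n) ^ 2)); [apply Cpow_nz, Hf|].
  rewrite E. replace (S n + 1)%nat with (S (S n)) by lia. rewrite Nat.add_1_r.
  cbn [qpoch]. specialize (Hqp n). assert (A := Hf n). assert (B := Hf (S n)).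
  field. auto.
Qed.

(** * Bailey's lemma in the limit *)

Lemma Clim_Cmod_le (u : nat -> C) (l : C) (M : R) :
  Clim u l -> (forall n, (Cmod (u n) <= M)%R) -> (Cmod l <= M)%R.
Proof.
intros H B. apply Rnot_lt_le. intros L.
destruct (H (Cmod l - M)%R ltac:(lra)) as [N HN]. specialize (HN N (le_n N)). specialize (B N).
pose proof (Cmod_triangle (u N) (- (u N - l))) as T.
replace (u N + - (u N - l)) with l in T by ring. rewrite Cmod_opp in T. lra.
Qed.

Lemma qpoch_le_exp (x p : C) (n : nat) : (Cmod p < 1)%R -> (Cmod x <= 1)%R ->
  (Cmod (qpoch x p n) <= exp (1 / (1 - Cmod p)))%R.
Proof.
intros Hp Hx. rewrite qpoch_cprod. apply cprod_bounded; [split; [apply Cmod_ge_0 | exact Hp] | lra|].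
intros k. eapply Rle_trans; [apply Cmod_triangle|].
rewrite Cmod_1, Cmod_opp, Cmod_mult, Cmod_pow. apply Rplus_le_compat_l, Rmult_le_compat_r; [|exact Hx].
apply pow_le, Cmod_ge_0.
Qed.

Lemma Cmod_pow_le_1 (x : C) (n : nat) : (Cmod x <= 1)%R -> (Cmod (x ^ n) <= 1)%R.
Proof.
intros H. rewrite Cmod_pow, <- (pow1 n). apply pow_incr. split; [apply Cmod_ge_0 | exact H].
Qed.

(** One power of p taken out of each factor yields the decay |p|^n; the other power multiplies p^k -
    b and leaves a factor of modulus at most 1 + |p|^k, even when |b p| = 1. *)
Lemma bailey_delta_bound (p b : C) (n : nat) : (Cmod p < 1)%R -> (Cmod (b * p) <= 1)%R ->
  (Cmod (bailey_delta p b n) <= exp (1 / (1 - Cmod p)) * Cmod p ^ n)%R.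
Proof.
intros Hp Hb. pose proof (Cmod_ge_0 p) as P0.
assert (E : bailey_delta p b n = cprod (fun k => (p ^ k * p - b * p) * p ^ k) n * p ^ n).
{ unfold bailey_delta. induction n as [|n IH]; cbn [cprod]; [simpl; ring|].
  rewrite IH, Cpow_add_r, !Cpow_S. ring. }
rewrite E, Cmod_mult, Cmod_pow. apply Rmult_le_compat_r; [now apply pow_le|].
apply cprod_bounded; [lra | lra|]. intros k.
rewrite Cmod_mult. pose proof (Cmod_pow_le_1 p k ltac:(lra)) as Hk.
assert (T : (Cmod (p ^ k * p - b * p) <= Cmod (p ^ k) * Cmod p + 1)%R).
{ eapply Rle_trans; [apply Cmod_triangle|]. rewrite Cmod_opp, Cmod_mult. lra. }
rewrite <- Cmod_pow. pose proof (Cmod_ge_0 (p ^ k)).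
eapply Rle_trans; [apply Rmult_le_compat_r; [apply Cmod_ge_0 | exact T]|].
nra.
Qed.

(** Bailey's lemma as N -> oo, by Tannery's theorem on both sides. The decay comes from
    [bailey_delta] alone, so bounded [alpha] and [beta] suffice. *)
Lemma bailey_limit (p b : C) (alpha beta : nat -> C) (A B : R) :
  (Cmod p < 1)%R -> (Cmod (b * p) <= 1)%R ->
  (forall n, (Cmod (alpha n) <= A)%R) -> (forall n, (Cmod (beta n) <= B)%R) ->
  (forall n, beta n =
     csum (fun r => alpha r / (qpoch p p (n - r) * qpoch p p (n + r + 1))) (S n)) ->
  let f := fun n => bailey_delta p b n * beta n in
  let g := fun r => alpha r * bailey_delta p b r * qpoch_inf (p ^ (r + 2) * b) p in
  ex_series f /\ ex_series g /\ CSeries f = / qpoch_inf p p * CSeries g.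
Proof.
intros Hp Hb HA HB H f g.
pose proof (Cmod_ge_0 p) as P0.
assert (A0 : (0 <= A)%R) by (eapply Rle_trans; [apply Cmod_ge_0 | apply (HA 0%nat)]).
assert (B0 : (0 <= B)%R) by (eapply Rle_trans; [apply Cmod_ge_0 | apply (HB 0%nat)]).
assert (Hf := qpoch_factor_neq_0 p p Hp Hp).
assert (Hpp : forall n, qpoch p p n <> 0) by (intros n; apply qpoch_neq_0; auto).
assert (Hinf := qpoch_inf_neq_0 p p Hp Hf).
destruct (qpoch_inv_bounded p p Hp Hf) as [K [HK BK]].
assert (BK' := Clim_Cmod_le _ _ _ (Clim_inv _ _ Hinf (qpoch_inf_lim p p Hp)) BK).
set (X := exp (1 / (1 - Cmod p))).
assert (X0 : (0 <= X)%R) by (left; apply exp_pos).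
assert (Hd := fun n => bailey_delta_bound p b n Hp Hb). fold X in Hd.
assert (Hr : forall r, (Cmod (p ^ (r + 2) * b) <= 1)%R).
{ intros r. replace (p ^ (r + 2) * b) with (p ^ S r * (b * p))
    by (rewrite Cpow_add_r, !Cpow_S; ring).
  rewrite Cmod_mult. assert (Z := Cmod_pow_le_1 p (S r) ltac:(lra)).
  pose proof (Cmod_ge_0 (p ^ S r)). pose proof (Cmod_ge_0 (b * p)). nra. }
assert (Hq := fun r n => qpoch_le_exp (p ^ (r + 2) * b) p n Hp (Hr r)). fold X in Hq.
assert (Hqi := fun r => Clim_Cmod_le _ _ _ (qpoch_inf_lim (p ^ (r + 2) * b) p Hp) (Hq r)).
assert (Bf : forall n, (Cmod (f n) <= X * B * Cmod p ^ n)%R).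
{ intros n. unfold f. rewrite Cmod_mult.
  replace (X * B * Cmod p ^ n)%R with (X * Cmod p ^ n * B)%R by ring.
  apply Rmult_le_compat; auto using Cmod_ge_0. }
assert (Bd : forall n, (Cmod (alpha n * bailey_delta p b n) <= A * X * Cmod p ^ n)%R).
{ intros n. rewrite Cmod_mult, Rmult_assoc. apply Rmult_le_compat; auto using Cmod_ge_0. }
assert (Bg : forall n, (Cmod (g n) <= A * X * X * Cmod p ^ n)%R).
{ intros n. unfold g. rewrite Cmod_mult.
  replace (A * X * X * Cmod p ^ n)%R with (A * X * Cmod p ^ n * X)%R by ring.
  apply Rmult_le_compat; auto using Cmod_ge_0. }
assert (Ef : ex_series f) by (apply (ex_series_geom_bound f (X * B) (Cmod p)); auto).
assert (Eg : ex_series g) by (apply (ex_series_geom_bound g (A * X * X) (Cmod p)); auto).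
split; [exact Ef | split; [exact Eg|]].
assert (L1 : Clim (fun N => csum (fun n => / qpoch p p (N - n) * f n) (S N))
  (CSeries (fun n => / qpoch_inf p p * f n))).
{ apply (Clim_tannery _ _ (K * (X * B)) (Cmod p)); [lra| | |].
  - intros N n _. rewrite Cmod_mult, Rmult_assoc. apply Rmult_le_compat; auto using Cmod_ge_0.
  - intros n. apply Clim_mult; [|apply Clim_const].
    apply (Clim_inv (fun N => qpoch p p (N - n))); [exact Hinf|].
    apply (Clim_subseq _ _ _ n); [intros; lia | now apply qpoch_inf_lim].
  - intros n. rewrite Cmod_mult, Rmult_assoc. apply Rmult_le_compat; auto using Cmod_ge_0. }
assert (L2 : Clim (fun N => csum (fun r => / qpoch p p (N - r) * / qpoch p p (N + r + 1)
    * (alpha r * bailey_delta p b r * qpoch (p ^ (r + 2) * b) p (N - r))) (S N))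
  (CSeries (fun r => / qpoch_inf p p * / qpoch_inf p p * g r))).
{ assert (KK : forall x y, (Cmod x <= K)%R -> (Cmod y <= K)%R -> (Cmod (x * y) <= K * K)%R).
  { intros x y Hx Hy. rewrite Cmod_mult. apply Rmult_le_compat; auto using Cmod_ge_0. }
  apply (Clim_tannery _ _ (K * K * (A * X * X)) (Cmod p)); [lra| | |].
  - intros N n _. rewrite Cmod_mult, Rmult_assoc.
    apply Rmult_le_compat; auto using Cmod_ge_0.
    rewrite Cmod_mult. replace (A * X * X * Cmod p ^ n)%R with (A * X * Cmod p ^ n * X)%R by ring.
    apply Rmult_le_compat; auto using Cmod_ge_0.
  - intros n. assert (Q := qpoch_inf_lim p p Hp).
    apply Clim_mult; [apply Clim_mult|].
    + apply (Clim_inv (fun N => qpoch p p (N - n))); [exact Hinf|].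
      apply (Clim_subseq _ _ _ n); [intros; lia | exact Q].
    + apply (Clim_inv (fun N => qpoch p p (N + n + 1))); [exact Hinf|].
      apply (Clim_subseq _ _ (fun N => N + n + 1)%nat 0); [intros; lia | exact Q].
    + apply Clim_scal. apply (Clim_subseq _ _ _ n); [intros; lia | now apply qpoch_inf_lim].
  - intros n. rewrite Cmod_mult, Rmult_assoc. apply Rmult_le_compat; auto using Cmod_ge_0. }
rewrite CSeries_scal in L1, L2 by assumption.
(* In the limit the left side carries one factor 1/(p;p)_oo and the right side two; one of them
   cancels. *)
apply (Cmult_cancel_l (/ qpoch_inf p p)).
{ intros Z. apply C1_nz. rewrite <- (Cinv_l (qpoch_inf p p)) by exact Hinf. rewrite Z. ring. }
rewrite Cmult_assoc. eapply Clim_unique; [|exact L2].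
eapply Clim_ext; [|exact L1]. intros N. cbv beta.
assert (E := bailey_finite p b alpha beta N Hp H).
transitivity (csum (fun n => bailey_delta p b n * beta n / qpoch p p (N - n)) (S N)).
- apply csum_ext. intros n _. unfold f, Cdiv. ring.
- rewrite E. apply csum_ext. intros n _. field. auto.
Qed.

(** * Parts (i) and (ii) *)

Lemma CSeries_scal_ext (f g : nat -> C) (c : C) : ex_series g ->
  (forall n, f n = c * g n) -> ex_series f /\ CSeries f = c * CSeries g.
Proof.
intros Hg E. apply CSeries_correct in Hg.
assert (L : Clim (csum f) (c * CSeries g)).
{ eapply Clim_ext; [|apply (Clim_scal c _ _ Hg)]. intros n. cbv beta.
  rewrite <- csum_scal. apply csum_ext. intros; now rewrite E. }
split; [exact (ex_series_Clim _ _ L) | exact (CSeries_unique _ _ L)].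
Qed.

Lemma qpoch_inf_split (x p : C) (n : nat) : (Cmod p < 1)%R ->
  qpoch_inf x p = qpoch x p n * qpoch_inf (x * p ^ n) p.
Proof.
intros Hp. apply (Clim_unique (fun m => qpoch x p (n + m))).
- apply (Clim_subseq _ _ _ 0); [intros; lia | now apply qpoch_inf_lim].
- eapply Clim_ext; [|apply Clim_scal, qpoch_inf_lim; exact Hp].
  intros m. cbv beta. symmetry. apply qpoch_add.
Qed.

Lemma qpoch_inf_0 (p : C) : (Cmod p < 1)%R -> qpoch_inf 0 p = 1.
Proof.
intros Hp. apply (Clim_unique (qpoch 0 p)); [now apply qpoch_inf_lim|].
apply (Clim_ext (fun _ => 1)); [|apply Clim_const].
intros n. induction n as [|n IH]; [easy|]. cbn [qpoch]. rewrite <- IH. ring.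
Qed.

Lemma Cmod_inv_one_minus_le (x : C) (r : R) : (Cmod x <= r)%R -> (r < 1)%R ->
  (Cmod (/ (1 - x)) <= / (1 - r))%R.
Proof.
intros Hx Hr. rewrite Cmod_inv by (apply one_minus_neq_0; lra).
apply Rinv_le_contravar; [lra|].
pose proof (Cmod_triangle (1 - x) x) as T. replace (1 - x + x) with (RtoC 1) in T by ring.
rewrite Cmod_1 in T. lra.
Qed.

Lemma Cmod_odd_pow_le (q : C) (n : nat) : (Cmod q < 1)%R -> (Cmod (q ^ (2 * n + 1)) <= Cmod q)%R.
Proof.
intros Hq. rewrite Nat.add_1_r, Cpow_S, Cmod_mult.
pose proof (Cmod_pow_le_1 q (2 * n) ltac:(lra)). pose proof (Cmod_ge_0 q). nra.
Qed.

Lemma one_minus_odd_pow_neq_0 (q : C) (n : nat) : (Cmod q < 1)%R -> 1 - q ^ (2 * n + 1) <> 0.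
Proof.
intros Hq. apply one_minus_neq_0. eapply Rle_lt_trans; [now apply Cmod_odd_pow_le | exact Hq].
Qed.

Lemma one_plus_odd_pow_neq_0 (q : C) (n : nat) : (Cmod q < 1)%R -> 1 + q ^ (2 * n + 1) <> 0.
Proof.
intros Hq. replace (1 + q ^ (2 * n + 1)) with (1 - - q ^ (2 * n + 1)) by ring.
apply one_minus_neq_0. rewrite Cmod_opp.
eapply Rle_lt_trans; [now apply Cmod_odd_pow_le | exact Hq].
Qed.

Lemma Cmod_pow_m1 (n : nat) : Cmod ((- (1)) ^ n) = 1%R.
Proof. rewrite Cmod_pow, Cmod_opp, Cmod_1. apply pow1. Qed.

Lemma bailey_alpha_bound (q : C) (r : nat) : (Cmod q < 1)%R ->
  (Cmod (bailey_alpha q r) <= 2 / (1 - Cmod q))%R.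
Proof.
intros Hq. unfold bailey_alpha, Cdiv. rewrite !Cmod_mult, Cmod_pow_m1, Rmult_1_l.
pose proof (Cmod_odd_pow_le q r Hq) as X. pose proof (Cmod_ge_0 q).
pose proof (Cmod_inv_one_minus_le _ _ X Hq) as Y.
pose proof (Cmod_pow_le_1 q (r * (r + 1)) ltac:(lra)) as Z.
pose proof (Cmod_triangle 1 (q ^ (2 * r + 1))) as T. rewrite Cmod_1 in T.
apply Rmult_le_compat; auto using Cmod_ge_0.
- apply Rmult_le_pos; apply Cmod_ge_0.
- pose proof (Cmod_ge_0 (q ^ (r * (r + 1)))). pose proof (Cmod_ge_0 (1 + q ^ (2 * r + 1))). nra.
Qed.

Lemma bailey_sum (q b : C) : (Cmod q < 1)%R -> (Cmod (b * q ^ 2) <= 1)%R ->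
  let p := q ^ 2 in
  let f := fun n => bailey_delta p b n / qpoch q p (n + 1) ^ 2 in
  let g := fun r => bailey_alpha q r * bailey_delta p b r * qpoch_inf (p ^ (r + 2) * b) p in
  ex_series f /\ ex_series g /\ CSeries f = / qpoch_inf p p * CSeries g.
Proof.
intros Hq Hb p f g.
assert (Hp : (Cmod p < 1)%R) by (apply Cmod_pow_lt_1; [exact Hq | lia]).
assert (Hf := qpoch_factor_neq_0 q p Hq Hp).
destruct (qpoch_inv_bounded q p Hp Hf) as [K [HK BK]].
apply (bailey_limit p b (bailey_alpha q) (fun n => / qpoch q p (n + 1) ^ 2) (2 / (1 - Cmod q)) (K * K) Hp Hb).
- intros n. now apply bailey_alpha_bound.
- intros n. replace (/ qpoch q p (n + 1) ^ 2) with (/ qpoch q p (n + 1) * / qpoch q p (n + 1)).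
  + rewrite Cmod_mult. apply Rmult_le_compat; auto using Cmod_ge_0.
  + field. apply qpoch_neq_0. auto.
- intros n. now apply bailey_pair.
Qed.

Lemma Cpow_sq (q : C) (n : nat) : (q ^ 2) ^ n = q ^ (2 * n).
Proof. symmetry. apply Cpow_mult_r. Qed.

(** Here b = -1/q, and the infinite product in the r-th term is (-q;q^2)_oo / (-q;q^2)_(r+1). Its
    denominator exceeds the factor (-q;q^2)_r of [bailey_delta] by 1 + q^(2r+1), which cancels the
    numerator of [bailey_alpha]. *)
Lemma A2_identity (q : C) (hq0 : (0 < Cmod q)%R) (hq1 : (Cmod q < 1)%R) :
  let s := fun n : nat =>
     (- (1)) ^ n * q ^ (2 * n ^ 2 + 3 * n) / (1 - q ^ (2 * n + 1)) in
  ex_series (A2_term q) /\ ex_series s /\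
  A2 q = q * (qpoch_inf (- q) (q ^ 2) / qpoch_inf (q ^ 2) (q ^ 2)) * CSeries s.
Proof.
intros s.
assert (Q0 : q <> 0) by now apply Cmod_gt_0.
assert (Hp : (Cmod (q ^ 2) < 1)%R) by (apply Cmod_pow_lt_1; [exact hq1 | lia]).
assert (Hm : (Cmod (- q) < 1)%R) by now rewrite Cmod_opp.
assert (N1 := qpoch_inf_neq_0 _ _ Hp (qpoch_factor_neq_0 _ _ Hm Hp)).
assert (N2 := qpoch_inf_neq_0 _ _ Hp (qpoch_factor_neq_0 _ _ Hp Hp)).
destruct (bailey_sum q (- / q) hq1) as [Ef [Eg E]].
{ replace (- / q * q ^ 2) with (- q) by (field; exact Q0). lra. }
assert (D : forall n, bailey_delta (q ^ 2) (- / q) n = q ^ (n ^ 2 + 2 * n) * qpoch (- q) (q ^ 2) n).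
{ intros n. unfold bailey_delta. induction n as [|n IH]; cbn [cprod qpoch]; [simpl; ring|].
  rewrite IH. replace (S n ^ 2 + 2 * S n)%nat with (n ^ 2 + 2 * n + (2 * n + 3))%nat by (simpl; ring).
  rewrite !Cpow_add_r, Cpow_sq, !Cpow_S. simpl (q ^ 0). field. exact Q0. }
destruct (CSeries_scal_ext (A2_term q) _ q Ef) as [EA EA'].
{ intros n. unfold A2_term. rewrite D. cbv beta.
  replace ((n + 1) ^ 2)%nat with (S (n ^ 2 + 2 * n)) by (simpl; ring).
  rewrite Cpow_S. unfold Cdiv. ring. }
destruct (CSeries_scal_ext s _ (/ qpoch_inf (- q) (q ^ 2)) Eg) as [Es Es'].
{ intros n. rewrite D, (qpoch_inf_split (- q) (q ^ 2) (S n) Hp).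
  replace ((q ^ 2) ^ (n + 2) * - / q) with (- q * (q ^ 2) ^ S n)
    by (rewrite Cpow_add_r, !Cpow_S; field; exact Q0).
  unfold s, bailey_alpha. cbn [qpoch].
  assert (X := one_minus_odd_pow_neq_0 q n hq1). assert (Y := one_plus_odd_pow_neq_0 q n hq1).
  assert (Z := qpoch_neq_0 (- q) (q ^ 2) n (fun k _ => qpoch_factor_neq_0 _ _ Hm Hp k)).
  rewrite (qpoch_inf_split (- q) (q ^ 2) (S n) Hp) in N1.
  replace (1 - - q * (q ^ 2) ^ n) with (1 + q ^ (2 * n + 1))
    by (rewrite Cpow_sq, Cpow_add_r; ring).
  replace (2 * n ^ 2 + 3 * n)%nat with (n * (n + 1) + (n ^ 2 + 2 * n))%nat by (simpl; ring).
  rewrite (Cpow_add_r q (n * (n + 1))). field. repeat split; auto.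
  intros V. apply N1. rewrite V. ring. }
split; [exact EA | split; [exact Es|]].
unfold A2. rewrite EA', E, Es'. field. auto.
Qed.

(** * Integer powers and bilateral series *)

Lemma Cpowz_of_nat (x : C) (n : nat) : Cpowz x (Z.of_nat n) = x ^ n.
Proof. destruct n; [easy|]. simpl. now rewrite SuccNat2Pos.id_succ. Qed.

Lemma Cpowz_opp_of_nat (x : C) (n : nat) : Cpowz x (- Z.of_nat n) = / x ^ n.
Proof.
destruct n; [simpl; field|]. simpl. now rewrite SuccNat2Pos.id_succ.
Qed.

Lemma Cpowz_sub (x : C) (n m : nat) : x <> 0 ->
  Cpowz x (Z.of_nat n - Z.of_nat m) = x ^ n / x ^ m.
Proof.
intros Hx. destruct (Nat.le_ge_cases m n) as [H|H].
- replace (Z.of_nat n - Z.of_nat m)%Z with (Z.of_nat (n - m)) by lia.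
  rewrite Cpowz_of_nat. replace n with (n - m + m)%nat at 2 by lia.
  rewrite Cpow_add_r. field. now apply Cpow_nz.
- replace (Z.of_nat n - Z.of_nat m)%Z with (- Z.of_nat (m - n))%Z by lia.
  rewrite Cpowz_opp_of_nat. replace m with (m - n + n)%nat at 2 by lia.
  rewrite Cpow_add_r. field. split; now apply Cpow_nz.
Qed.

(** Reduces the laws of integer powers to natural ones through [Cpowz_sub], avoiding case analysis
    on signs. *)
Lemma Z_diff_nat (z : Z) : exists n m : nat, z = (Z.of_nat n - Z.of_nat m)%Z.
Proof. exists (Z.to_nat z), (Z.to_nat (- z)). lia. Qed.

Lemma Cpowz_add (x : C) (a b : Z) : x <> 0 -> Cpowz x (a + b) = Cpowz x a * Cpowz x b.
Proof.
intros Hx. destruct (Z_diff_nat a) as [n [m ->]]. destruct (Z_diff_nat b) as [k [l ->]].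
replace (Z.of_nat n - Z.of_nat m + (Z.of_nat k - Z.of_nat l))%Z
  with (Z.of_nat (n + k) - Z.of_nat (m + l))%Z by lia.
rewrite !Cpowz_sub, !Cpow_add_r by exact Hx. field. split; now apply Cpow_nz.
Qed.

Lemma Cpowz_pow (x : C) (k : nat) (a : Z) : x <> 0 ->
  Cpowz (x ^ k) a = Cpowz x (Z.of_nat k * a).
Proof.
intros Hx. destruct (Z_diff_nat a) as [n [m ->]].
replace (Z.of_nat k * (Z.of_nat n - Z.of_nat m))%Z
  with (Z.of_nat (k * n) - Z.of_nat (k * m))%Z by lia.
rewrite !Cpowz_sub, !Cpow_mult_r by (try apply Cpow_nz; exact Hx). easy.
Qed.

Lemma Cpowz_nonneg (x : C) (a : Z) (n : nat) : a = Z.of_nat n -> Cpowz x a = x ^ n.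
Proof. intros ->. apply Cpowz_of_nat. Qed.

Lemma Cpowz_nonpos (x : C) (a : Z) (n : nat) : a = (- Z.of_nat n)%Z -> Cpowz x a = / x ^ n.
Proof. intros ->. apply Cpowz_opp_of_nat. Qed.

Lemma Cpow_m1_sq (n : nat) : (- (1)) ^ n * (- (1)) ^ n = 1.
Proof. rewrite <- Cpow_mult_l. replace (- (1) * - (1)) with (RtoC 1) by ring. apply Cpow_1_l. Qed.

Lemma Cpow_m1_neq_0 (n : nat) : (- (1)) ^ n <> 0.
Proof. intros Z. apply C1_nz. rewrite <- (Cpow_m1_sq n), Z. ring. Qed.

Lemma Cpow_m1_inv (n : nat) : / (- (1)) ^ n = (- (1)) ^ n.
Proof.
apply (Cmult_cancel_l ((- (1)) ^ n)); [apply Cpow_m1_neq_0|].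
rewrite Cpow_m1_sq. field. apply Cpow_m1_neq_0.
Qed.

Lemma CSeries_Z_split (a : Z -> C) (f g : nat -> C) :
  (forall n, a (Z.of_nat n) = f n) -> (forall n, a (- Z.of_nat (S n))%Z = g n) ->
  ex_series f -> ex_series g -> ex_series_Z a /\ CSeries_Z a = CSeries f + CSeries g.
Proof.
intros Ef Eg Hf Hg. split.
- split; [apply (ex_series_ext f) | apply (ex_series_ext g)]; auto.
- unfold CSeries_Z. f_equal; now apply CSeries_ext.
Qed.

Lemma ex_series_q_bound (q : C) (f u : nat -> C) (E : nat -> nat) (M : R) :
  (Cmod q < 1)%R -> (forall n, f n = u n * q ^ E n) -> (forall n, (Cmod (u n) <= M)%R) ->
  (forall n, (n <= E n)%nat) -> ex_series f.
Proof.
intros Hq Hf Hu HE. pose proof (Cmod_ge_0 q). apply (ex_series_geom_bound f M (Cmod q)); [lra|].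
intros n. rewrite Hf, Cmod_mult.
replace (E n) with (n + (E n - n))%nat by (specialize (HE n); lia).
rewrite Cpow_add_r, Cmod_mult, Cmod_pow. pose proof (Cmod_pow_le_1 q (E n - n) ltac:(lra)).
pose proof (pow_le (Cmod q) n ltac:(lra)). pose proof (Cmod_ge_0 (q ^ (E n - n))).
apply Rmult_le_compat; auto using Cmod_ge_0; nra.
Qed.

Lemma ex_series_lambert (q : C) (f : nat -> C) (E k : nat -> nat) :
  (Cmod q < 1)%R -> (forall n, (n <= E n)%nat) -> (forall n, (0 < k n)%nat) ->
  (forall n, f n = (- (1)) ^ n * q ^ E n / (1 - q ^ k n)) -> ex_series f.
Proof.
intros Hq HE Hk Hf.
apply (ex_series_q_bound q f (fun n => (- (1)) ^ n * / (1 - q ^ k n)) E (/ (1 - Cmod q)) Hq);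
  [intros n; rewrite Hf; unfold Cdiv; ring | | exact HE].
intros n. rewrite Cmod_mult, Cmod_pow_m1, Rmult_1_l. apply Cmod_inv_one_minus_le; [|exact Hq].
replace (k n) with (S (k n - 1)) by (specialize (Hk n); lia). rewrite Cpow_S, Cmod_mult.
pose proof (Cmod_pow_le_1 q (k n - 1) ltac:(lra)). pose proof (Cmod_ge_0 q). nra.
Qed.

(** With b = -1/q^2 the finite products cancel completely and 1 + q^(2r+1) survives; its two
    summands are the terms of index r and -r-1 of the bilateral series. *)
Lemma B2_identity (q : C) (hq0 : (0 < Cmod q)%R) (hq1 : (Cmod q < 1)%R) :
  let s := fun n : Z =>
     Cpowz (- (1)) n * Cpowz q (2 * n ^ 2 + 2 * n) / (1 - Cpowz q (2 * n + 1)) in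
  ex_series (B2_term q) /\ ex_series_Z s /\
  B2 q = qpoch_inf (- q ^ 2) (q ^ 2) / qpoch_inf (q ^ 2) (q ^ 2) * CSeries_Z s.
Proof.
intros s.
assert (Q0 : q <> 0) by now apply Cmod_gt_0.
assert (Hp : (Cmod (q ^ 2) < 1)%R) by (apply Cmod_pow_lt_1; [exact hq1 | lia]).
assert (Hm : (Cmod (- q ^ 2) < 1)%R) by now rewrite Cmod_opp.
assert (N1 := qpoch_inf_neq_0 _ _ Hp (qpoch_factor_neq_0 _ _ Hm Hp)).
destruct (bailey_sum q (- / q ^ 2) hq1) as [Ef [Eg E]].
{ replace (- / q ^ 2 * q ^ 2) with (- (1)) by (field; exact Q0). rewrite Cmod_opp, Cmod_1. lra. }
assert (D : forall n, bailey_delta (q ^ 2) (- / q ^ 2) n = q ^ (n ^ 2 + n) * qpoch (- q ^ 2) (q ^ 2) n).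
{ intros n. unfold bailey_delta. induction n as [|n IH]; cbn [cprod qpoch]; [simpl; ring|].
  rewrite IH. replace (S n ^ 2 + S n)%nat with (n ^ 2 + n + (2 * n + 2))%nat by (simpl; ring).
  rewrite !Cpow_add_r, Cpow_sq, !Cpow_S. simpl (q ^ 0). field. exact Q0. }
destruct (CSeries_scal_ext (B2_term q) _ 1 Ef) as [EB EB'].
{ intros n. unfold B2_term. rewrite D. ring. }
set (t1 := fun n => (- (1)) ^ n * q ^ (2 * n ^ 2 + 2 * n) / (1 - q ^ (2 * n + 1))).
(* The term of index -n-1: the exponent 2n^2 + 2n is invariant, and -1/(1 - q^(-2n-1)) = q^(2n+1)/(1
   - q^(2n+1)). *)
set (t2 := fun n => (- (1)) ^ n * q ^ (2 * n ^ 2 + 2 * n + (2 * n + 1)) / (1 - q ^ (2 * n + 1))).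
assert (E1 : ex_series t1).
{ apply (ex_series_lambert q t1 (fun n => 2 * n ^ 2 + 2 * n)%nat (fun n => 2 * n + 1)%nat hq1);
    [intros; lia | intros; lia | easy]. }
assert (E2 : ex_series t2).
{ apply (ex_series_lambert q t2 (fun n => 2 * n ^ 2 + 2 * n + (2 * n + 1))%nat (fun n => 2 * n + 1)%nat hq1);
    [intros; lia | intros; lia | easy]. }
destruct (CSeries_Z_split s t1 t2) as [ES ES']; auto.
{ intros n. unfold s, t1. rewrite Cpowz_of_nat.
  now rewrite (Cpowz_nonneg q _ (2 * n ^ 2 + 2 * n)), (Cpowz_nonneg q _ (2 * n + 1)) by (simpl Nat.pow; nia). }
{ intros n. unfold s, t2. rewrite Cpowz_opp_of_nat, Cpow_m1_inv, Cpow_S.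
  rewrite (Cpowz_nonneg q _ (2 * n ^ 2 + 2 * n)), (Cpowz_nonpos q _ (2 * n + 1)) by (simpl Nat.pow; nia).
  rewrite (Cpow_add_r q _ (2 * n + 1)). assert (X := one_minus_odd_pow_neq_0 q n hq1).
  assert (Y := Cpow_nz q (2 * n + 1) Q0). field. repeat split; auto.
  intros Z. apply X. rewrite <- Copp_0, <- Z. ring. }
split; [exact EB | split; [exact ES|]].
unfold B2. rewrite EB', E, ES', <- CSeries_plus by assumption.
destruct (CSeries_scal_ext (fun n => t1 n + t2 n) _ (/ qpoch_inf (- q ^ 2) (q ^ 2)) Eg) as [Es Es'].
{ intros n. rewrite D, (qpoch_inf_split (- q ^ 2) (q ^ 2) n Hp).
  rewrite (qpoch_inf_split (- q ^ 2) (q ^ 2) n Hp) in N1.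
  replace ((q ^ 2) ^ (n + 2) * - / q ^ 2) with (- q ^ 2 * (q ^ 2) ^ n)
    by (rewrite Cpow_add_r, !Cpow_S; field; exact Q0).
  unfold t1, t2, bailey_alpha.
  assert (X := one_minus_odd_pow_neq_0 q n hq1).
  assert (Z := qpoch_neq_0 (- q ^ 2) (q ^ 2) n (fun k _ => qpoch_factor_neq_0 _ _ Hm Hp k)).
  rewrite (Cpow_add_r q _ (2 * n + 1)).
  replace (2 * n ^ 2 + 2 * n)%nat with (n * (n + 1) + (n ^ 2 + n))%nat by (simpl; ring).
  rewrite (Cpow_add_r q (n * (n + 1))). field. repeat split; auto.
  intros V. apply N1. rewrite V. ring. }
rewrite Es'. field. split; auto.
apply (qpoch_inf_neq_0 _ _ Hp (qpoch_factor_neq_0 _ _ Hp Hp)).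
Qed.

(** * Parts (iii) and (iv) *)

(** In the limit of the Bailey pair itself no [bailey_delta] supplies decay, so [bailey_alpha] must
    provide it. *)
Lemma bailey_alpha_geom_bound (q : C) (r : nat) : (Cmod q < 1)%R ->
  (Cmod (bailey_alpha q r) <= 2 / (1 - Cmod q) * Cmod q ^ r)%R.
Proof.
intros Hq. unfold bailey_alpha, Cdiv. rewrite !Cmod_mult, Cmod_pow_m1, Rmult_1_l.
pose proof (Cmod_odd_pow_le q r Hq) as X. pose proof (Cmod_ge_0 q) as Q0.
pose proof (Cmod_inv_one_minus_le _ _ X Hq) as Y.
assert (Z : (Cmod (q ^ (r * (r + 1))) <= Cmod q ^ r)%R).
{ replace (r * (r + 1))%nat with (r * r + r)%nat by ring. rewrite Cpow_add_r, Cmod_mult, (Cmod_pow q r).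
  pose proof (Cmod_pow_le_1 q (r * r) ltac:(lra)). pose proof (pow_le _ r Q0). nra. }
pose proof (Cmod_triangle 1 (q ^ (2 * r + 1))) as T. rewrite Cmod_1 in T.
replace (2 / (1 - Cmod q) * Cmod q ^ r)%R with (Cmod q ^ r * 2 * / (1 - Cmod q))%R
  by (unfold Rdiv; ring).
apply Rmult_le_compat; auto using Cmod_ge_0.
- apply Rmult_le_pos; apply Cmod_ge_0.
- apply Rmult_le_compat; auto using Cmod_ge_0. lra.
Qed.

(** Let n -> oo in [bailey_pair]. With q^3 for q the value is (q^6;q^6)_oo^2 / (q^3;q^6)_oo^2 =
    J_6^3/J_{3,6}. *)
Lemma bailey_pair_limit (q : C) : (Cmod q < 1)%R ->
  let p := q ^ 2 in
  ex_series (bailey_alpha q) /\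
  CSeries (bailey_alpha q) = qpoch_inf p p ^ 2 / qpoch_inf q p ^ 2.
Proof.
intros Hq p. pose proof (Cmod_ge_0 q) as Q0.
assert (Hp : (Cmod p < 1)%R) by (apply Cmod_pow_lt_1; [exact Hq | lia]).
assert (Hf := qpoch_factor_neq_0 q p Hq Hp).
assert (Hf' := qpoch_factor_neq_0 p p Hp Hp).
assert (N1 := qpoch_inf_neq_0 _ _ Hp Hf). assert (N2 := qpoch_inf_neq_0 _ _ Hp Hf').
destruct (qpoch_inv_bounded p p Hp Hf') as [K [HK BK]].
assert (Q := qpoch_inf_lim p p Hp).
assert (BK' := Clim_Cmod_le _ _ _ (Clim_inv _ _ N2 Q) BK).
assert (Ea : ex_series (bailey_alpha q)).
{ apply (ex_series_geom_bound _ (2 / (1 - Cmod q)) (Cmod q)); [lra|].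
  intros n. now apply bailey_alpha_geom_bound. }
split; [exact Ea|].
assert (L : Clim (fun N => csum (fun r => / qpoch p p (N - r) * / qpoch p p (N + r + 1) * bailey_alpha q r) (S N))
  (CSeries (fun r => / qpoch_inf p p * / qpoch_inf p p * bailey_alpha q r))).
{ assert (KK : forall x y, (Cmod x <= K)%R -> (Cmod y <= K)%R -> (Cmod (x * y) <= K * K)%R).
  { intros x y Hx Hy. rewrite Cmod_mult. apply Rmult_le_compat; auto using Cmod_ge_0. }
  apply (Clim_tannery _ _ (K * K * (2 / (1 - Cmod q))) (Cmod q)); [lra| | |].
  - intros N n _. rewrite Cmod_mult, Rmult_assoc.
    apply Rmult_le_compat; auto using Cmod_ge_0. now apply bailey_alpha_geom_bound.
  - intros n. apply Clim_mult; [|apply Clim_const]. apply Clim_mult.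
    + apply (Clim_inv (fun N => qpoch p p (N - n))); [exact N2|].
      apply (Clim_subseq _ _ _ n); [intros; lia | exact Q].
    + apply (Clim_inv (fun N => qpoch p p (N + n + 1))); [exact N2|].
      apply (Clim_subseq _ _ (fun N => N + n + 1)%nat 0); [intros; lia | exact Q].
  - intros n. rewrite Cmod_mult, Rmult_assoc.
    apply Rmult_le_compat; auto using Cmod_ge_0. now apply bailey_alpha_geom_bound. }
rewrite CSeries_scal in L by exact Ea.
assert (L' : Clim (fun n => / (qpoch q p (n + 1) * qpoch q p (n + 1)))
  (/ (qpoch_inf q p * qpoch_inf q p))).
{ apply Clim_inv; [now apply Cmult_neq_0|].
  apply Clim_mult; apply (Clim_subseq _ _ (fun n => n + 1)%nat 0);
    (intros; lia) || now apply qpoch_inf_lim. }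
assert (E : / (qpoch_inf q p * qpoch_inf q p)
  = / qpoch_inf p p * / qpoch_inf p p * CSeries (bailey_alpha q)).
{ apply (Clim_unique _ _ _ L'). eapply Clim_ext; [|exact L]. intros n. cbv beta.
  replace (qpoch q p (n + 1) * qpoch q p (n + 1)) with (qpoch q p (n + 1) ^ 2) by ring.
  unfold p at 5. rewrite bailey_pair by exact Hq. apply csum_ext. intros r _. fold p. field.
  split; apply qpoch_neq_0; auto. }
transitivity (qpoch_inf p p * qpoch_inf p p * / (qpoch_inf q p * qpoch_inf q p)); [|field; auto].
rewrite E. field. auto.
Qed.

(** For b = 0, [bailey_delta] is a pure power of q and the infinite product on the right is 1. *)
Lemma third_sum_first_identity (q : C) (hq0 : (0 < Cmod q)%R) (hq1 : (Cmod q < 1)%R) :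
  let s := fun n : nat => q ^ (2 * n * (n + 1)) / qpoch q (q ^ 2) (n + 1) ^ 2 in
  let t := fun n : nat =>
     (- (1)) ^ n * ((1 + q ^ (2 * n + 1)) / (1 - q ^ (2 * n + 1))) * q ^ (3 * n ^ 2 + 3 * n) in
  ex_series s /\ ex_series t /\ CSeries s = 1 / qpoch_inf (q ^ 2) (q ^ 2) * CSeries t.
Proof.
intros s t.
assert (Hp : (Cmod (q ^ 2) < 1)%R) by (apply Cmod_pow_lt_1; [exact hq1 | lia]).
destruct (bailey_sum q 0 hq1) as [Ef [Eg E]].
{ replace (0 * q ^ 2) with (RtoC 0) by ring. rewrite Cmod_0. lra. }
assert (D : forall n, bailey_delta (q ^ 2) 0 n = q ^ (2 * n * (n + 1))).
{ intros n. unfold bailey_delta. induction n as [|n IH]; cbn [cprod]; [simpl; ring|].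
  rewrite IH. replace (2 * S n * (S n + 1))%nat with (2 * n * (n + 1) + (2 * n + 2 * n + 4))%nat by ring.
  rewrite !Cpow_add_r, Cpow_sq. ring. }
destruct (CSeries_scal_ext s _ 1 Ef) as [Es Es'].
{ intros n. rewrite D. unfold s. ring. }
destruct (CSeries_scal_ext t _ 1 Eg) as [Et Et'].
{ intros n. rewrite D, Cmult_0_r, qpoch_inf_0 by exact Hp. unfold t, bailey_alpha.
  replace (3 * n ^ 2 + 3 * n)%nat with (n * (n + 1) + 2 * n * (n + 1))%nat by (simpl; ring).
  rewrite (Cpow_add_r q (n * (n + 1))). unfold Cdiv. ring. }
split; [exact Es | split; [exact Et|]]. rewrite Es', E, Et'. unfold Cdiv. ring.
Qed.

(** For b = 1/q^2 the product in the r-th term is (q^2;q^2)_oo / (q^2;q^2)_r, which removes both the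
    prefactor and the finite product. The sign of [bailey_delta] cancels that of [bailey_alpha], so
    the right side does not alternate. *)
Lemma fourth_sum_first_identity (q : C) (hq0 : (0 < Cmod q)%R) (hq1 : (Cmod q < 1)%R) :
  let s := fun n : nat =>
     (- (1)) ^ n * q ^ (n * (n + 1)) * qpoch (q ^ 2) (q ^ 2) n / qpoch q (q ^ 2) (n + 1) ^ 2 in
  let t := fun n : nat =>
     (1 + q ^ (2 * n + 1)) / (1 - q ^ (2 * n + 1)) * q ^ (2 * n ^ 2 + 2 * n) in
  ex_series s /\ ex_series t /\ CSeries s = CSeries t.
Proof.
intros s t.
assert (Q0 : q <> 0) by now apply Cmod_gt_0.
assert (Hp : (Cmod (q ^ 2) < 1)%R) by (apply Cmod_pow_lt_1; [exact hq1 | lia]).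
assert (N1 := qpoch_inf_neq_0 _ _ Hp (qpoch_factor_neq_0 _ _ Hp Hp)).
destruct (bailey_sum q (/ q ^ 2) hq1) as [Ef [Eg E]].
{ replace (/ q ^ 2 * q ^ 2) with (RtoC 1) by (field; exact Q0). rewrite Cmod_1. lra. }
assert (D : forall n, bailey_delta (q ^ 2) (/ q ^ 2) n
  = (- (1)) ^ n * q ^ (n * (n + 1)) * qpoch (q ^ 2) (q ^ 2) n).
{ intros n. unfold bailey_delta. induction n as [|n IH]; cbn [cprod qpoch]; [simpl; ring|].
  rewrite IH. replace (S n * (S n + 1))%nat with (n * (n + 1) + (2 * n + 2))%nat by ring.
  rewrite !Cpow_add_r, Cpow_sq, !Cpow_S. simpl (q ^ 0). field. exact Q0. }
destruct (CSeries_scal_ext s _ 1 Ef) as [Es Es'].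
{ intros n. rewrite D. unfold s. ring. }
destruct (CSeries_scal_ext t _ (/ qpoch_inf (q ^ 2) (q ^ 2)) Eg) as [Et Et'].
{ intros n. rewrite D, (qpoch_inf_split (q ^ 2) (q ^ 2) n Hp).
  rewrite (qpoch_inf_split (q ^ 2) (q ^ 2) n Hp) in N1.
  replace ((q ^ 2) ^ (n + 2) * / q ^ 2) with (q ^ 2 * (q ^ 2) ^ n)
    by (rewrite Cpow_add_r, !Cpow_S; field; exact Q0).
  unfold t, bailey_alpha. assert (X := one_minus_odd_pow_neq_0 q n hq1).
  assert (Z := qpoch_neq_0 (q ^ 2) (q ^ 2) n (fun k _ => qpoch_factor_neq_0 _ _ Hp Hp k)).
  replace (2 * n ^ 2 + 2 * n)%nat with (n * (n + 1) + n * (n + 1))%nat by (simpl; ring).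
  rewrite (Cpow_add_r q (n * (n + 1))).
  transitivity ((- (1)) ^ n * (- (1)) ^ n * ((1 + q ^ (2 * n + 1)) / (1 - q ^ (2 * n + 1))
    * (q ^ (n * (n + 1)) * q ^ (n * (n + 1))))).
  - rewrite Cpow_m1_sq. ring.
  - field. repeat split; auto. intros V. apply N1. rewrite V. ring. }
split; [exact Es | split; [exact Et|]]. rewrite Es', E, Et'. ring.
Qed.

(** * Appell-Lerch terms as powers of q *)

Lemma Cpowz_tri (q : C) (k : nat) (r : Z) : q <> 0 ->
  Cpowz (q ^ (2 * k)) (r * (r - 1) / 2) = Cpowz q (Z.of_nat k * (r * (r - 1))).
Proof.
intros Hq. rewrite Cpowz_pow by exact Hq. f_equal.
assert (H : exists m, (r * (r - 1) = m * 2)%Z).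
{ destruct (Z.Even_or_Odd r) as [[m ->]|[m ->]]; [exists (m * (2 * m - 1))%Z | exists ((2 * m + 1) * m)%Z]; ring. }
destruct H as [m H]. rewrite H, Z.div_mul by lia. lia.
Qed.

Lemma Cpowz_m1_sq (r : Z) : Cpowz (- (1)) r * Cpowz (- (1)) r = 1.
Proof.
destruct (Z_diff_nat r) as [n [m ->]].
assert (N : - (1) <> 0) by (rewrite <- (Cpow_1_r (- (1))); apply Cpow_m1_neq_0).
rewrite Cpowz_sub by exact N. unfold Cdiv. rewrite Cpow_m1_inv.
transitivity (((- (1)) ^ n * (- (1)) ^ n) * ((- (1)) ^ m * (- (1)) ^ m)); [ring|].
rewrite !Cpow_m1_sq. ring.
Qed.

Lemma Cpowz_mult_l (x y : C) (r : Z) : x <> 0 -> y <> 0 -> Cpowz (x * y) r = Cpowz x r * Cpowz y r.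
Proof.
intros Hx Hy. destruct (Z_diff_nat r) as [n [m ->]].
rewrite !Cpowz_sub, !Cpow_mult_l by (try apply Cmult_neq_0; assumption).
field. split; now apply Cpow_nz.
Qed.

(** The sign in z = -q^j cancels the explicit (-1)^r, and the signs of x and z cancel in x z =
    q^(e+j). *)
Lemma mbar_term_closed (q : C) (e j : nat) (r : Z) : q <> 0 ->
  mbar_term (- q ^ e) (q ^ 4) (- q ^ j) r =
  sg r * Cpowz q (2 * r ^ 2 - 2 * r + Z.of_nat j * r)
    / (1 - Cpowz q (4 * r - 4 + Z.of_nat (e + j))).
Proof.
intros Hq. unfold mbar_term.
assert (N : - (1) <> 0) by (rewrite <- (Cpow_1_r (- (1))); apply Cpow_m1_neq_0).
replace (- q ^ j) with (- (1) * q ^ j) at 1 by ring.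
rewrite Cpowz_mult_l by (try apply Cpow_nz; assumption).
change 4%nat with (2 * 2)%nat at 1. rewrite Cpowz_tri, !Cpowz_pow by exact Hq.
replace (Cpowz q (Z.of_nat 4 * (r - 1)) * - q ^ e * - q ^ j)
  with (Cpowz q (Z.of_nat 4 * (r - 1)) * Cpowz q (Z.of_nat (e + j)))
  by (rewrite Cpowz_of_nat, Cpow_add_r; ring).
rewrite <- Cpowz_add by exact Hq.
replace (Z.of_nat 4 * (r - 1) + Z.of_nat (e + j))%Z with (4 * r - 4 + Z.of_nat (e + j))%Z by lia.
replace (2 * r ^ 2 - 2 * r + Z.of_nat j * r)%Z
  with (Z.of_nat 2 * (r * (r - 1)) + Z.of_nat j * r)%Z by (simpl Z.of_nat; ring).
rewrite (Cpowz_add q (Z.of_nat 2 * (r * (r - 1)))) by exact Hq. unfold Cdiv.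
transitivity (Cpowz (- (1)) r * Cpowz (- (1)) r * (sg r * (Cpowz q (Z.of_nat 2 * (r * (r - 1)))
  * Cpowz q (Z.of_nat j * r)) * / (1 - Cpowz q (4 * r - 4 + Z.of_nat (e + j))))); [ring|].
rewrite Cpowz_m1_sq. ring.
Qed.

Lemma m_term_closed (q : C) (j : nat) (r : Z) : q <> 0 ->
  m_term q (q ^ 6) (q ^ j) r =
  Cpowz (- (1)) r * Cpowz q (3 * r ^ 2 - 3 * r + Z.of_nat j * r)
    / (1 - Cpowz q (6 * r - 5 + Z.of_nat j)).
Proof.
intros Hq. unfold m_term.
change 6%nat with (2 * 3)%nat at 1. rewrite Cpowz_tri, !Cpowz_pow by exact Hq.
replace (Cpowz q (Z.of_nat 6 * (r - 1)) * q * q ^ j)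
  with (Cpowz q (Z.of_nat 6 * (r - 1)) * Cpowz q (Z.of_nat (S j)))
  by (rewrite Cpowz_of_nat, Cpow_S; ring).
rewrite <- Cpowz_add by exact Hq.
replace (Z.of_nat 6 * (r - 1) + Z.of_nat (S j))%Z with (6 * r - 5 + Z.of_nat j)%Z by lia.
replace (3 * r ^ 2 - 3 * r + Z.of_nat j * r)%Z
  with (Z.of_nat 3 * (r * (r - 1)) + Z.of_nat j * r)%Z by (simpl Z.of_nat; ring).
rewrite (Cpowz_add q (Z.of_nat 3 * (r * (r - 1)))) by exact Hq. unfold Cdiv. ring.
Qed.

Lemma CSeries_S (h : nat -> C) : ex_series (fun n => h (S n)) ->
  ex_series h /\ CSeries h = h 0%nat + CSeries (fun n => h (S n)).
Proof.
intros H. apply CSeries_correct in H.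
assert (L : Clim (csum h) (h 0%nat + CSeries (fun n => h (S n)))).
{ apply (Clim_ext_ev (fun n => csum h (S (n - 1))) _ _ 1).
  - intros n Hn. f_equal. lia.
  - apply (Clim_subseq (fun n => csum h (S n)) _ (fun n => n - 1)%nat 1); [intros; lia|].
    eapply Clim_ext; [|apply (Clim_plus _ _ _ _ (Clim_const (h 0%nat)) H)].
    intros n. cbv beta. now rewrite csum_S_l. }
split; [exact (ex_series_Clim _ _ L) | exact (CSeries_unique _ _ L)].
Qed.

(** Cuts between r = 0 and r = 1 instead of between -1 and 0: the terms of m(q,q^6,q^2) and
    m(q,q^6,q^4) are matched as r = n + 1 and r = -n. *)
Lemma CSeries_Z_split_1 (a : Z -> C) (f g : nat -> C) :
  (forall n, a (Z.of_nat n + 1)%Z = f n) -> (forall n, a (- Z.of_nat n)%Z = g n) ->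
  ex_series f -> ex_series g -> ex_series_Z a /\ CSeries_Z a = CSeries f + CSeries g.
Proof.
intros Ef Eg Hf Hg.
destruct (CSeries_S (fun n => a (Z.of_nat n))) as [H1 H2].
{ apply (ex_series_ext f); [|exact Hf]. intros n. rewrite <- Ef. f_equal. lia. }
assert (Hg' : ex_series (fun n => g (S n))) by exact (proj1 (ex_series_incr_1 (V := C_NormedModule) g) Hg).
destruct (CSeries_S g Hg') as [_ H3].
destruct (CSeries_Z_split a (fun n => a (Z.of_nat n)) (fun n => g (S n))) as [H4 H5]; auto.
split; [exact H4|]. rewrite H5, H2, H3, <- Eg. simpl (a (Z.of_nat 0)). simpl (a (- Z.of_nat 0)%Z).
rewrite (CSeries_ext (fun n => a (Z.of_nat (S n))) f); [ring | | exact Hf].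
intros n. rewrite <- Ef. f_equal. lia.
Qed.

(** With x = q^(2n+1), (1 + x)/(1 - x) = (1 + 2x + x^2)/(1 - x^2). The two halves of the first
    [mbar] supply 1 and x^2; those of the second, multiplied by q, supply x each. The sign [sg]
    makes the halves add. *)
Lemma fourth_sum_mbar (q : C) (hq0 : (0 < Cmod q)%R) (hq1 : (Cmod q < 1)%R) :
  let t := fun n : nat =>
     (1 + q ^ (2 * n + 1)) / (1 - q ^ (2 * n + 1)) * q ^ (2 * n ^ 2 + 2 * n) in
  ex_series_Z (mbar_term (- q ^ 2) (q ^ 4) (- q ^ 4)) /\
  ex_series_Z (mbar_term (- (1)) (q ^ 4) (- q ^ 6)) /\
  CSeries t = mbar (- q ^ 2) (q ^ 4) (- q ^ 4) + q * mbar (- (1)) (q ^ 4) (- q ^ 6).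
Proof.
intros t.
assert (Q0 : q <> 0) by now apply Cmod_gt_0.
assert (X : forall n, 1 - q ^ (4 * n + 2) <> 0).
{ intros n. apply one_minus_neq_0, Cmod_pow_lt_1; [exact hq1 | lia]. }
assert (EX : forall c d, ex_series (fun n => q ^ (2 * n ^ 2 + c * n + d) / (1 - q ^ (4 * n + 2)))).
{ intros c d. apply (ex_series_q_bound q _ (fun n => / (1 - q ^ (4 * n + 2)))
    (fun n => 2 * n ^ 2 + c * n + d)%nat (/ (1 - Cmod q)) hq1).
  - intros n. unfold Cdiv. ring.
  - intros n. apply Cmod_inv_one_minus_le; [|exact hq1].
    replace (4 * n + 2)%nat with (2 * (2 * n) + 1 + 1)%nat by lia. rewrite Cpow_add_r, Cmod_mult.
    pose proof (Cmod_odd_pow_le q (2 * n) hq1). pose proof (Cmod_pow_le_1 q 1 ltac:(lra)).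
    pose proof (Cmod_ge_0 (q ^ (2 * (2 * n) + 1))). pose proof (Cmod_ge_0 (q ^ 1)). nra.
  - intros n. simpl Nat.pow. nia. }
assert (S0 : forall n, sg (Z.of_nat n) = 1) by (intros n; unfold sg; now rewrite (proj2 (Z.leb_le _ _)) by lia).
assert (S1 : forall n, sg (- Z.of_nat (S n)) = - (1)) by (intros n; unfold sg; now rewrite (proj2 (Z.leb_gt _ _)) by lia).
destruct (CSeries_Z_split (mbar_term (- q ^ 2) (q ^ 4) (- q ^ 4))
  (fun n => q ^ (2 * n ^ 2 + 2 * n + 0) / (1 - q ^ (4 * n + 2)))
  (fun n => q ^ (2 * n ^ 2 + 6 * n + 2) / (1 - q ^ (4 * n + 2)))) as [E1 E1']; auto.
{ intros n. rewrite mbar_term_closed, S0 by exact Q0.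
  rewrite (Cpowz_nonneg q _ (2 * n ^ 2 + 2 * n + 0)), (Cpowz_nonneg q _ (4 * n + 2)) by (simpl Nat.pow; nia).
  unfold Cdiv. ring. }
{ intros n. rewrite mbar_term_closed, S1 by exact Q0.
  rewrite (Cpowz_nonneg q _ (2 * n ^ 2 + 2 * n)), (Cpowz_nonpos q _ (4 * n + 2)) by (simpl Nat.pow; nia).
  replace (2 * n ^ 2 + 6 * n + 2)%nat with (2 * n ^ 2 + 2 * n + (4 * n + 2))%nat by lia.
  rewrite (Cpow_add_r q _ (4 * n + 2)). specialize (X n).
  assert (Y := Cpow_nz q (4 * n + 2) Q0). field. repeat split; auto.
  intros Z. apply X. rewrite <- Copp_0, <- Z. ring. }
destruct (CSeries_Z_split (mbar_term (- (1)) (q ^ 4) (- q ^ 6))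
  (fun n => q ^ (2 * n ^ 2 + 4 * n + 0) / (1 - q ^ (4 * n + 2)))
  (fun n => q ^ (2 * n ^ 2 + 4 * n + 0) / (1 - q ^ (4 * n + 2)))) as [E2 E2']; auto.
(* The argument -1 is read as -q^0 to fit the closed form with e = 0. *)
{ intros n. change (RtoC 1) with (q ^ 0) at 1. rewrite mbar_term_closed, S0 by exact Q0.
  rewrite (Cpowz_nonneg q _ (2 * n ^ 2 + 4 * n + 0)), (Cpowz_nonneg q _ (4 * n + 2)) by (simpl Nat.pow; nia).
  unfold Cdiv. ring. }
{ intros n. change (RtoC 1) with (q ^ 0) at 1. rewrite mbar_term_closed, S1 by exact Q0.
  (* The exponent is 2n^2 - 2, negative at n = 0, so it is kept as a difference; the subtracted 4n +
     2 is absorbed by the denominator. *)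
  replace (2 * (- Z.of_nat (S n)) ^ 2 - 2 * - Z.of_nat (S n) + Z.of_nat 6 * - Z.of_nat (S n))%Z
    with (Z.of_nat (2 * n ^ 2 + 4 * n + 0) + - Z.of_nat (4 * n + 2))%Z by (simpl Nat.pow; nia).
  rewrite Cpowz_add by exact Q0.
  rewrite (Cpowz_nonneg q _ (2 * n ^ 2 + 4 * n + 0)), !(Cpowz_nonpos q _ (4 * n + 2)) by (simpl Nat.pow; nia).
  specialize (X n). assert (Y := Cpow_nz q (4 * n + 2) Q0). field. repeat split; auto.
  intros Z. apply X. rewrite <- Copp_0, <- Z. ring. }
split; [exact E1 | split; [exact E2|]].
unfold mbar. rewrite E1', E2'.
apply CSeries_unique. eapply csum_lim_ext; [|apply csum_lim_plus;
  [|apply csum_lim_scal]; apply csum_lim_plus; apply CSeries_correct; apply EX].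
intros n. cbv beta. unfold t. rewrite Nat.add_0_r.
assert (P := one_minus_odd_pow_neq_0 q n hq1). assert (P' := one_plus_odd_pow_neq_0 q n hq1).
replace (2 * n ^ 2 + 4 * n + 0)%nat with (2 * n ^ 2 + 2 * n + 2 * n)%nat by lia.
replace (2 * n ^ 2 + 6 * n + 2)%nat with (2 * n ^ 2 + 2 * n + ((2 * n + 1) + (2 * n + 1)))%nat by lia.
specialize (X n). replace (4 * n + 2)%nat with ((2 * n + 1) + (2 * n + 1))%nat in * by lia.
rewrite !(Cpow_add_r q (2 * n ^ 2 + 2 * n)), !(Cpow_add_r q (2 * n + 1)) in *.
rewrite (Cpow_add_r q (2 * n) 1), Cpow_1_r in *.
field. auto.
Qed.

(** The common shape of the four half-series of m(q,q^6,q^2) and m(q,q^6,q^4) once the factor -q and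
    the theta prefactor are removed. *)
Definition lambert (q : C) (c d k n : nat) : C :=
  (- (1)) ^ n * q ^ (3 * n ^ 2 + c * n + d) / (1 - q ^ (6 * n + k)).

Lemma lambert_bound (q : C) (c d k n : nat) : (Cmod q < 1)%R ->
  (Cmod (lambert q c d (S k) n) <= / (1 - Cmod q) * Cmod q ^ n)%R.
Proof.
intros Hq. pose proof (Cmod_ge_0 q) as Q0. unfold lambert, Cdiv.
rewrite !Cmod_mult, Cmod_pow_m1, Rmult_1_l, Rmult_comm.
apply Rmult_le_compat; auto using Cmod_ge_0.
- apply Cmod_inv_one_minus_le; [|exact Hq].
  replace (6 * n + S k)%nat with (S (6 * n + k)) by lia. rewrite Cpow_S, Cmod_mult.
  pose proof (Cmod_pow_le_1 q (6 * n + k) ltac:(lra)). nra.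
- replace (3 * n ^ 2 + c * n + d)%nat with (n + (3 * n ^ 2 + c * n + d - n))%nat by (simpl Nat.pow; nia).
  rewrite Cpow_add_r, Cmod_mult, (Cmod_pow q n).
  pose proof (Cmod_pow_le_1 q (3 * n ^ 2 + c * n + d - n) ltac:(lra)).
  pose proof (pow_le _ n Q0). nra.
Qed.

Lemma ex_series_lambert_q (q : C) (c d k : nat) : (Cmod q < 1)%R -> ex_series (lambert q c d (S k)).
Proof.
intros Hq. apply (ex_series_geom_bound _ (/ (1 - Cmod q)) (Cmod q)).
- split; [apply Cmod_ge_0 | exact Hq].
- intros n. now apply lambert_bound.
Qed.

Lemma third_sum_lambert (q : C) (hq0 : (0 < Cmod q)%R) (hq1 : (Cmod q < 1)%R) :
  let A := CSeries (lambert q 7 3 5) + CSeries (lambert q 5 0 1) in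
  let B := CSeries (lambert q 5 1 3) + CSeries (lambert q 7 2 3) in
  (ex_series_Z (m_term q (q ^ 6) (q ^ 4)) /\
   CSeries_Z (m_term q (q ^ 6) (q ^ 4)) = - q * A) /\
  (ex_series_Z (m_term q (q ^ 6) (q ^ 2)) /\
   CSeries_Z (m_term q (q ^ 6) (q ^ 2)) = - q * B) /\
  CSeries (fun n => (- (1)) ^ n * ((1 + q ^ (2 * n + 1)) / (1 - q ^ (2 * n + 1)))
       * q ^ (3 * n ^ 2 + 3 * n)) = CSeries (bailey_alpha (q ^ 3)) + 2 * B.
Proof.
intros A B.
assert (Q0 : q <> 0) by now apply Cmod_gt_0.
assert (X : forall n k, 1 - q ^ (6 * n + S k) <> 0).
{ intros n k. apply one_minus_neq_0, Cmod_pow_lt_1; [exact hq1 | lia]. }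
assert (EX := fun c d k => ex_series_lambert_q q c d k hq1).
assert (EX' : forall c d k, ex_series (fun n => - q * lambert q c d (S k) n)).
{ intros c d k. eexists. apply is_series_Clim, csum_lim_scal, CSeries_correct, EX. }
split; [|split].
- destruct (CSeries_Z_split_1 (m_term q (q ^ 6) (q ^ 4))
    (fun n => - q * lambert q 7 3 5 n) (fun n => - q * lambert q 5 0 1 n)) as [E1 E1']; auto.
  + intros n. rewrite m_term_closed by exact Q0.
    replace (Z.of_nat n + 1)%Z with (Z.of_nat (S n)) by lia. rewrite Cpowz_of_nat, Cpow_S.
    rewrite (Cpowz_nonneg q _ (S (3 * n ^ 2 + 7 * n + 3))), (Cpowz_nonneg q _ (6 * n + 5)) by (simpl Nat.pow; nia).
    unfold lambert. rewrite Cpow_S. unfold Cdiv. ring.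
  + intros n. rewrite m_term_closed, Cpowz_opp_of_nat, Cpow_m1_inv by exact Q0.
    replace (3 * (- Z.of_nat n) ^ 2 - 3 * - Z.of_nat n + Z.of_nat 4 * - Z.of_nat n)%Z
      with (Z.of_nat (3 * n ^ 2 + 5 * n + 0) + 1 + - Z.of_nat (6 * n + 1))%Z by (simpl Nat.pow; nia).
    rewrite (Cpowz_nonpos q (6 * - Z.of_nat n - 5 + Z.of_nat 4) (6 * n + 1)) by lia.
    rewrite !Cpowz_add, Cpowz_opp_of_nat, !Cpowz_of_nat by exact Q0.
    change (Cpowz q 1) with (q ^ 1). rewrite Cpow_1_r.
    unfold lambert. specialize (X n 0%nat). assert (Y := Cpow_nz q (6 * n + 1) Q0). field. repeat split; auto.
    intros Z. apply X. rewrite <- Copp_0, <- Z. ring.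
  + split; [exact E1|]. rewrite E1', !CSeries_scal by apply EX. unfold A. ring.
- destruct (CSeries_Z_split_1 (m_term q (q ^ 6) (q ^ 2))
    (fun n => - q * lambert q 5 1 3 n) (fun n => - q * lambert q 7 2 3 n)) as [E1 E1']; auto.
  + intros n. rewrite m_term_closed by exact Q0.
    replace (Z.of_nat n + 1)%Z with (Z.of_nat (S n)) by lia. rewrite Cpowz_of_nat, Cpow_S.
    rewrite (Cpowz_nonneg q _ (S (3 * n ^ 2 + 5 * n + 1))), (Cpowz_nonneg q _ (6 * n + 3)) by (simpl Nat.pow; nia).
    unfold lambert. rewrite Cpow_S. unfold Cdiv. ring.
  + intros n. rewrite m_term_closed, Cpowz_opp_of_nat, Cpow_m1_inv by exact Q0.
    replace (3 * (- Z.of_nat n) ^ 2 - 3 * - Z.of_nat n + Z.of_nat 2 * - Z.of_nat n)%Z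
      with (Z.of_nat (3 * n ^ 2 + 7 * n + 2) + 1 + - Z.of_nat (6 * n + 3))%Z by (simpl Nat.pow; nia).
    rewrite (Cpowz_nonpos q (6 * - Z.of_nat n - 5 + Z.of_nat 2) (6 * n + 3)) by lia.
    rewrite !Cpowz_add, Cpowz_opp_of_nat, !Cpowz_of_nat by exact Q0.
    change (Cpowz q 1) with (q ^ 1). rewrite Cpow_1_r.
    unfold lambert. specialize (X n 2%nat). assert (Y := Cpow_nz q (6 * n + 3) Q0). field. repeat split; auto.
    intros Z. apply X. rewrite <- Copp_0, <- Z. ring.
  + split; [exact E1|]. rewrite E1', !CSeries_scal by apply EX. unfold B. ring.
- assert (Hq3 : (Cmod (q ^ 3) < 1)%R) by (apply Cmod_pow_lt_1; [exact hq1 | lia]).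
  destruct (bailey_pair_limit (q ^ 3) Hq3) as [Ea _]. unfold B.
  apply CSeries_unique. eapply csum_lim_ext; [|apply csum_lim_plus;
    [|apply csum_lim_scal, csum_lim_plus]; apply CSeries_correct; first [exact Ea | apply EX]].
  intros n. cbv beta. unfold bailey_alpha, lambert. rewrite <- !Cpow_mult_r.
  assert (P := one_minus_odd_pow_neq_0 q n hq1). specialize (X n 2%nat).
  (* All exponents of q are 3n^2 + 3n plus multiples of 2n + 1, so the termwise claim becomes a
     rational identity in [x]. *)
  set (x := q ^ (2 * n + 1)) in *.
  replace (3 * (n * (n + 1)))%nat with (3 * n ^ 2 + 3 * n)%nat by (simpl; ring).
  replace (3 * n ^ 2 + 5 * n + 1)%nat with (3 * n ^ 2 + 3 * n + (2 * n + 1))%nat by lia.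
  replace (3 * n ^ 2 + 7 * n + 2)%nat with (3 * n ^ 2 + 3 * n + (2 * n + 1) + (2 * n + 1))%nat by lia.
  replace (3 * (2 * n + 1))%nat with ((2 * n + 1) * 3)%nat by lia.
  replace (6 * n + 3)%nat with ((2 * n + 1) * 3)%nat in * by lia.
  rewrite !(Cpow_add_r q _ (2 * n + 1)), !Cpow_mult_r in *. fold x in X |- *.
  field. repeat split; auto.
Qed.

(** * Partial fractions and the change of z *)

(** The coefficient of 1/(1 - a_i x) in the expansion of prod_{l<M} (u_l + v_l x) / prod_{l<=M} (1 -
    a_l x). General linear factors allow constants and plain x in the numerator, so its length can
    be padded to M. *)
Definition pf_coef (a u v : nat -> C) (M i : nat) : C :=
  cprod (fun l => u l + v l * / a i) M
    / cprod (fun l => if (l =? i)%nat then 1 else 1 - a l * / a i) (S M).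

(** Induction on M: multiplying by (u_M + v_M x)/(1 - b x) splits each old fraction into one at a_i
    and one at b. The contributions at b add up to the induction hypothesis evaluated at x = 1/b. *)
Lemma partial_fractions (a u v : nat -> C) (M : nat) (x : C) :
  (forall i, (i <= M)%nat -> a i <> 0) ->
  (forall i j, (i <= M)%nat -> (j <= M)%nat -> i <> j -> a i <> a j) ->
  (forall i, (i <= M)%nat -> 1 - a i * x <> 0) ->
  cprod (fun l => u l + v l * x) M / cprod (fun l => 1 - a l * x) (S M) =
  csum (fun i => pf_coef a u v M i / (1 - a i * x)) (S M).
Proof.
revert x. induction M as [|M IH]; intros x Ha Hd Hx.
- unfold pf_coef. simpl. specialize (Hx 0%nat (le_n 0)). field. exact Hx.
- assert (Dn : forall i j, (i <= S M)%nat -> (j <= S M)%nat -> i <> j -> 1 - a i * / a j <> 0).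
  { intros i j Hi Hj Hij Z. apply (Hd i j Hi Hj Hij).
    replace (a j) with (a j * (1 - (1 - a i * / a j))) by (rewrite Z; ring). field. auto. }
  set (b := a (S M)). assert (Hb : b <> 0) by (apply Ha; lia).
  assert (IHx := IH x ltac:(intros; apply Ha; lia) ltac:(intros; apply Hd; lia) ltac:(intros; apply Hx; lia)).
  assert (IHb := IH (/ b) ltac:(intros; apply Ha; lia) ltac:(intros; apply Hd; lia)
    ltac:(intros; apply Dn; lia)).
  assert (Hbx : 1 - b * x <> 0) by (apply Hx; lia).
  assert (Hpx : cprod (fun l => 1 - a l * x) (S M) <> 0).
  { apply cprod_neq_0. intros i Hi. apply Hx. lia. }
  assert (E : pf_coef a u v (S M) (S M) = (u M + v M * / b)
    * (cprod (fun l => u l + v l * / b) M / cprod (fun l => 1 - a l * / b) (S M))).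
  { unfold pf_coef. fold b. cbn [cprod]. rewrite !Nat.eqb_refl.
    replace (M =? S M)%nat with false by (symmetry; apply Nat.eqb_neq; lia).
    rewrite (cprod_ext (fun l => if (l =? S M)%nat then 1 else 1 - a l * / b) (fun l => 1 - a l * / b)).
    - assert (cprod (fun l => 1 - a l * / b) M <> 0).
      { apply cprod_neq_0. intros i Hi. apply Dn; lia. }
      assert (1 - a M * / b <> 0) by (apply Dn; lia).
      unfold Cdiv. rewrite Cmult_1_r. ring.
    - intros l Hl. replace (l =? S M)%nat with false; [easy|]. symmetry. apply Nat.eqb_neq. lia. }
  transitivity ((u M + v M * x) / (1 - b * x)
    * (cprod (fun l => u l + v l * x) M / cprod (fun l => 1 - a l * x) (S M))).
  { change (cprod (fun l => 1 - a l * x) (S (S M)))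
      with (cprod (fun l => 1 - a l * x) (S M) * (1 - b * x)).
    change (cprod (fun l => u l + v l * x) (S M)) with (cprod (fun l => u l + v l * x) M * (u M + v M * x)).
    field. auto. }
  change (csum (fun i => pf_coef a u v (S M) i / (1 - a i * x)) (S (S M)))
    with (csum (fun i => pf_coef a u v (S M) i / (1 - a i * x)) (S M)
      + pf_coef a u v (S M) (S M) / (1 - b * x)).
  rewrite E, IHx, IHb.
  transitivity (csum (fun i => pf_coef a u v (S M) i / (1 - a i * x)
    + (u M + v M * / b) / (1 - b * x) * (pf_coef a u v M i / (1 - a i * / b))) (S M)).
  2: { rewrite csum_plus, csum_scal. unfold Cdiv. ring. }
  rewrite <- csum_scal. apply csum_ext. intros i Hi.
  assert (Hai : a i <> 0) by (apply Ha; lia). assert (1 - a i * x <> 0) by (apply Hx; lia).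
  assert (Hab : b - a i <> 0).
  { intros Z. apply (Hd (S M) i); try lia. fold b. replace b with (b - a i + a i) by ring. rewrite Z. ring. }
  assert (Hba : a i - b <> 0) by (intros Z; apply Hab; replace (b - a i) with (- (a i - b)) by ring; rewrite Z; ring).
  assert (Ei : pf_coef a u v (S M) i = pf_coef a u v M i * ((u M + v M * / a i) / (1 - b * / a i))).
  { unfold pf_coef.
    change (cprod (fun l => if (l =? i)%nat then 1 else 1 - a l * / a i) (S (S M)))
      with (cprod (fun l => if (l =? i)%nat then 1 else 1 - a l * / a i) (S M)
        * (if (S M =? i)%nat then 1 else 1 - b * / a i)).
    change (cprod (fun l => u l + v l * / a i) (S M))
      with (cprod (fun l => u l + v l * / a i) M * (u M + v M * / a i)).
    replace (S M =? i)%nat with false by (symmetry; apply Nat.eqb_neq; lia).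
    assert (1 - b * / a i <> 0) by (apply Dn; lia).
    assert (cprod (fun l => if (l =? i)%nat then 1 else 1 - a l * / a i) (S M) <> 0).
    { apply cprod_neq_0. intros l Hl. destruct (Nat.eqb_spec l i); [apply C1_nz | apply Dn; lia]. }
    field. repeat split; auto. }
  rewrite Ei.
  field. repeat split; auto.
Qed.

(** Reflects the factors with negative powers of p: 1 - c p^(-j) = -c p^(-j) (1 - p^j / c) for 1 <=
    j <= k. *)
Lemma qpoch_over_pow (c p : C) (k m : nat) : c <> 0 -> p <> 0 ->
  qpoch (c * / p ^ k) p (k + m) =
  (- (1)) ^ k * c ^ k * / cprod (fun l => p ^ S l) k * (qpoch (p * / c) p k * qpoch c p m).
Proof.
intros Hc Hp. induction k as [|k IH].
- simpl. rewrite <- (Cmult_1_r c) at 2. replace (c * / 1) with (c * 1) by (f_equal; field).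
  rewrite Cmult_1_r. field.
- change (S k + m)%nat with (S (k + m)). rewrite qpoch_S_l.
  replace (c * / p ^ S k * p) with (c * / p ^ k)
    by (rewrite Cpow_S; field; split; [now apply Cpow_nz | exact Hp]).
  rewrite IH. cbn [qpoch cprod]. rewrite !Cpow_S.
  assert (cprod (fun l => p ^ S l) k <> 0) by (apply cprod_neq_0; intros; now apply Cpow_nz).
  assert (p ^ k <> 0) by now apply Cpow_nz.
  field. auto.
Qed.

(** The product over the other poles of the same geometric family: i factors below the omitted one,
    reflected with c = 1, and m above it. *)
Lemma cprod_skip (p : C) (i m : nat) : p <> 0 ->
  cprod (fun l => if (l =? i)%nat then 1 else 1 - p ^ l * / p ^ i) (i + 1 + m) =
  (- (1)) ^ i * / cprod (fun l => p ^ S l) i * (qpoch p p i * qpoch p p m).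
Proof.
intros Hp. rewrite !cprod_add. cbn [cprod]. rewrite Nat.add_0_r, Nat.eqb_refl.
rewrite (cprod_ext _ (fun l => 1 - 1 * / p ^ i * p ^ l)).
2: { intros l Hl. replace (l =? i)%nat with false by (symmetry; apply Nat.eqb_neq; lia). ring. }
rewrite (cprod_ext (fun k => if (i + 1 + k =? i)%nat then _ else _) (fun k => 1 - p * p ^ k)).
2: { intros l Hl. replace (i + 1 + l =? i)%nat with false by (symmetry; apply Nat.eqb_neq; lia).
  rewrite !Cpow_add_r, Cpow_1_r. field. now apply Cpow_nz. }
rewrite <- !qpoch_cprod. rewrite <- (Nat.add_0_r i) at 2.
rewrite qpoch_over_pow by (auto using C1_nz). rewrite Cpow_1_l. cbn [qpoch].
replace (p * / 1) with p by (field). ring.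
Qed.

(* Poles and linear factors of
   x^k prod_{l<N} (1 - x q^(6l)) / ((1 - x q^(6l+2)) (1 - x q^(6l+4))), N = 2k+2;
   the power x^k balances the coefficients between the two ends of the window. *)
Definition cz_pole (q : C) (N l : nat) : C :=
  q ^ (if (l <? N)%nat then 2 + 6 * l else 4 + 6 * (l - N)).

(** Constant and linear coefficients of the numerator list: N factors 1 - x q^(6l), then k copies of
    x, then ones as padding up to one factor fewer than there are poles. *)
Definition cz_num0 (N k l : nat) : C :=
  if (l <? N)%nat then 1 else if (l <? N + k)%nat then 0 else 1.

Definition cz_num1 (q : C) (N k l : nat) : C :=
  if (l <? N)%nat then - (q ^ 6) ^ l else if (l <? N + k)%nat then 1 else 0.

(** The part of the coefficient at the pole q^(2+6i) made of q-Pochhammer symbols, with N = i + 1 +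
    m; it tends to 1/(q^6;q^6)_oo^2 as i and m grow. [cz2] is its analogue for q^(4+6i). *)
Definition cz1 (q : C) (i m : nat) : C :=
  qpoch (q ^ 2) (q ^ 6) (S i) * qpoch (q ^ 4) (q ^ 6) m
    / (qpoch (q ^ 6) (q ^ 6) i * qpoch (q ^ 6) (q ^ 6) m
       * qpoch (q ^ 4) (q ^ 6) i * qpoch (q ^ 2) (q ^ 6) (S m)).

Definition cz2 (q : C) (i m : nat) : C :=
  qpoch (q ^ 4) (q ^ 6) (S i) * qpoch (q ^ 2) (q ^ 6) m
    / (qpoch (q ^ 6) (q ^ 6) i * qpoch (q ^ 6) (q ^ 6) m
       * qpoch (q ^ 2) (q ^ 6) (S i) * qpoch (q ^ 4) (q ^ 6) m).

Lemma cz_num_prod (q x : C) (N k j : nat) :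
  cprod (fun l => cz_num0 N k l + cz_num1 q N k l * x) (N + (k + j)) = qpoch x (q ^ 6) N * x ^ k.
Proof.
rewrite !cprod_add, qpoch_cprod. unfold cz_num0, cz_num1.
rewrite (cprod_ext _ (fun l => 1 - x * (q ^ 6) ^ l)).
2: { intros l Hl. replace (l <? N)%nat with true by (symmetry; apply Nat.ltb_lt; lia). ring. }
rewrite (cprod_ext (fun l => (if (N + l <? N)%nat then _ else _) + _) (fun _ => x)).
2: { intros l Hl. replace (N + l <? N)%nat with false by (symmetry; apply Nat.ltb_ge; lia).
  replace (N + l <? N + k)%nat with true by (symmetry; apply Nat.ltb_lt; lia). ring. }
rewrite (cprod_ext (fun l => (if (N + (k + l) <? N)%nat then _ else _) + _) (fun _ => 1)).
2: { intros l Hl. replace (N + (k + l) <? N)%nat with false by (symmetry; apply Nat.ltb_ge; lia).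
  replace (N + (k + l) <? N + k)%nat with false by (symmetry; apply Nat.ltb_ge; lia). ring. }
replace (cprod (fun _ => 1) j) with (RtoC 1) by (induction j as [|j IH]; cbn [cprod]; [|rewrite <- IH]; ring).
rewrite Cmult_1_r. f_equal.
induction k as [|k IH]; [easy|]. cbn [cprod]. rewrite IH, Cpow_S. ring.
Qed.

Lemma cz_den_prod (q y : C) (N : nat) :
  cprod (fun l => 1 - cz_pole q N l * y) (N + N) =
  qpoch (q ^ 2 * y) (q ^ 6) N * qpoch (q ^ 4 * y) (q ^ 6) N.
Proof.
rewrite cprod_add, !qpoch_cprod. unfold cz_pole. f_equal; apply cprod_ext; intros l Hl.
- replace (l <? N)%nat with true by (symmetry; apply Nat.ltb_lt; lia).
  rewrite Cpow_add_r, Cpow_mult_r. ring.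
- replace (N + l <? N)%nat with false by (symmetry; apply Nat.ltb_ge; lia).
  replace (N + l - N)%nat with l by lia. rewrite Cpow_add_r, Cpow_mult_r. ring.
Qed.

Lemma cz_tri (q : C) (i : nat) : cprod (fun l => (q ^ 6) ^ S l) i = q ^ (3 * (i * (i + 1))).
Proof.
induction i as [|i IH]; [easy|]. cbn [cprod]. rewrite IH, <- Cpow_mult_r, <- Cpow_add_r.
f_equal. lia.
Qed.

(** At x = q^(-2-6i) the numerator is reflected with c = q^(-2), the family q^(4+6l) with c = q^2,
    and the pole's own family falls under [cprod_skip]. The leading minus sign comes from 1 - q^(-2)
    = -q^(-2) (1 - q^2). *)
Lemma cz_coef1 (q : C) (i m k j : nat) : (0 < Cmod q)%R -> (Cmod q < 1)%R ->
  let N := (i + 1 + m)%nat in (N + (k + j) = N + N - 1)%nat ->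
  pf_coef (cz_pole q N) (cz_num0 N k) (cz_num1 q N k) (N + (k + j)) i =
  - ((- (1)) ^ i * (q ^ (3 * (i * (i + 1))) / (q ^ (4 * i + 2) * q ^ ((2 + 6 * i) * k))) * cz1 q i m).
Proof.
intros hq0 hq1 N HN. unfold pf_coef. rewrite cz_num_prod.
assert (Q0 : q <> 0) by now apply Cmod_gt_0.
assert (HP : forall j, (Cmod (q ^ S j) < 1)%R) by (intros; apply Cmod_pow_lt_1; [exact hq1 | lia]).
assert (P0 : forall j, q ^ j <> 0) by (intros; now apply Cpow_nz).
assert (NZ : forall j l, qpoch (q ^ S j) (q ^ 6) l <> 0).
{ intros j' l. apply qpoch_neq_0. intros r _. now apply qpoch_factor_neq_0. }
replace (S (N + (k + j))) with (N + N)%nat by (unfold N in *; lia).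
rewrite cprod_add.
rewrite (cprod_ext _ (fun l => if (l =? i)%nat then 1 else 1 - (q ^ 6) ^ l * / (q ^ 6) ^ i)).
2: { intros l Hl. destruct (Nat.eqb_spec l i); [easy|]. unfold cz_pole.
  rewrite !(proj2 (Nat.ltb_lt _ _)) by (unfold N in *; lia).
  rewrite !Cpow_add_r, !Cpow_mult_r. field. split; [now apply Cpow_nz | exact Q0]. }
rewrite (cprod_ext (fun k => if (N + k =? i)%nat then _ else _) (fun l => 1 - q ^ 2 * / (q ^ 6) ^ i * (q ^ 6) ^ l)).
2: { intros l Hl. replace (N + l =? i)%nat with false by (symmetry; apply Nat.eqb_neq; unfold N in *; lia).
  unfold cz_pole.
  rewrite (proj2 (Nat.ltb_lt i N)), (proj2 (Nat.ltb_ge _ _)) by (unfold N in *; lia).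
  replace (N + l - N)%nat with l by lia.
  rewrite !Cpow_add_r, !Cpow_mult_r. field. split; [now apply Cpow_nz | exact Q0]. }
assert (Sk := cprod_skip (q ^ 6) i m (P0 6%nat)). fold N in Sk.
rewrite <- qpoch_cprod, Sk, cz_tri.
unfold cz_pole. rewrite (proj2 (Nat.ltb_lt i N)) by (unfold N in *; lia).
unfold N. replace (i + 1 + m)%nat with (i + S m)%nat by lia.
rewrite qpoch_over_pow, cz_tri by apply P0.
replace (/ q ^ (2 + 6 * i)) with (/ q ^ 2 * / (q ^ 6) ^ i) at 1
  by (rewrite Cpow_add_r, Cpow_mult_r; field; split; [now apply Cpow_nz | exact Q0]).
assert (P2 : / q ^ 2 <> 0).
{ intros Z. apply C1_nz. replace (RtoC 1) with (q ^ 2 * / q ^ 2) by (field; exact Q0). rewrite Z. ring. }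
rewrite qpoch_over_pow, cz_tri by (exact P2 || apply P0).
replace (q ^ 6 * / / q ^ 2) with (q ^ 2 * q ^ 6) by (field; exact Q0).
replace (q ^ 6 * / q ^ 2) with (q ^ 4) by (field; exact Q0).
rewrite (qpoch_S_l (/ q ^ 2)).
replace (/ q ^ 2 * q ^ 6) with (q ^ 4) by (field; exact Q0).
unfold cz1. assert (E := qpoch_S_l (q ^ 2) (q ^ 6) i). rewrite E.
assert (E8 : qpoch (q ^ 2 * q ^ 6) (q ^ 6) i <> 0).
{ intros Z. apply (NZ 1%nat (S i)). rewrite E, Z. ring. }
rewrite !Cpow_inv by apply P0.
replace (q ^ (4 * i + 2)) with ((q ^ 2) ^ i * (q ^ 2) ^ i * q ^ 2)
  by (rewrite <- Cpow_mult_r, <- !Cpow_add_r; f_equal; lia).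
rewrite (Cpow_mult_r q (2 + 6 * i) k).
assert (A1 := NZ 1%nat (S m)). assert (A2 := NZ 3%nat i). assert (A3 := NZ 5%nat i). assert (A4 := NZ 5%nat m).
assert (A5 : (q ^ (2 + 6 * i)) ^ k <> 0) by (apply Cpow_nz, P0).
assert (A6 : (q ^ 2) ^ i <> 0) by (apply Cpow_nz, P0).
assert (A7 := P0 (3 * (i * (i + 1)))%nat). assert (A8 := Cpow_m1_neq_0 i).
rewrite <- (Cpow_m1_inv i) at 4. field. repeat split; auto.
Qed.

(** As for the other family, with c = q^(-4) in the numerator and c = q^(-2) in the denominator. The
    signs of 1 - q^(-4) and 1 - q^(-2) cancel, whence the relative minus sign between the
    families. *)
Lemma cz_coef2 (q : C) (i m k j : nat) : (0 < Cmod q)%R -> (Cmod q < 1)%R ->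
  let N := (i + 1 + m)%nat in (N + (k + j) = N + N - 1)%nat ->
  pf_coef (cz_pole q N) (cz_num0 N k) (cz_num1 q N k) (N + (k + j)) (N + i) =
  (- (1)) ^ i * (q ^ (3 * (i * (i + 1))) / (q ^ (2 * i + 2) * q ^ ((4 + 6 * i) * k))) * cz2 q i m.
Proof.
intros hq0 hq1 N HN. unfold pf_coef. rewrite cz_num_prod.
assert (Q0 : q <> 0) by now apply Cmod_gt_0.
assert (HP : forall j, (Cmod (q ^ S j) < 1)%R) by (intros; apply Cmod_pow_lt_1; [exact hq1 | lia]).
assert (P0 : forall j, q ^ j <> 0) by (intros; now apply Cpow_nz).
assert (NZ : forall j l, qpoch (q ^ S j) (q ^ 6) l <> 0).
{ intros j' l. apply qpoch_neq_0. intros r _. now apply qpoch_factor_neq_0. }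
assert (I0 : forall j, / q ^ j <> 0).
{ intros j' Z. apply C1_nz. replace (RtoC 1) with (q ^ j' * / q ^ j') by (field; apply P0).
  rewrite Z. ring. }
replace (S (N + (k + j))) with (N + N)%nat by (unfold N in *; lia).
rewrite cprod_add.
rewrite (cprod_ext (fun l => if (l =? N + i)%nat then _ else _) (fun l => 1 - / q ^ 2 * / (q ^ 6) ^ i * (q ^ 6) ^ l)).
2: { intros l Hl. replace (l =? N + i)%nat with false by (symmetry; apply Nat.eqb_neq; lia).
  unfold cz_pole.
  rewrite (proj2 (Nat.ltb_lt l N)), (proj2 (Nat.ltb_ge _ _)) by lia.
  replace (N + i - N)%nat with i by lia.
  rewrite !Cpow_add_r, !Cpow_mult_r. field. split; [now apply Cpow_nz | exact Q0]. }
rewrite (cprod_ext (fun k => if (N + k =? N + i)%nat then _ else _)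
  (fun l => if (l =? i)%nat then 1 else 1 - (q ^ 6) ^ l * / (q ^ 6) ^ i)).
2: { intros l Hl. destruct (Nat.eqb_spec l i) as [->|h]; [now rewrite Nat.eqb_refl|].
  replace (N + l =? N + i)%nat with false by (symmetry; apply Nat.eqb_neq; lia). unfold cz_pole.
  rewrite !(proj2 (Nat.ltb_ge _ _)) by lia.
  replace (N + l - N)%nat with l by lia. replace (N + i - N)%nat with i by lia.
  rewrite !Cpow_add_r, !Cpow_mult_r. field. split; [now apply Cpow_nz | exact Q0]. }
assert (Sk := cprod_skip (q ^ 6) i m (P0 6%nat)). fold N in Sk.
rewrite <- qpoch_cprod, Sk, cz_tri.
unfold cz_pole. rewrite (proj2 (Nat.ltb_ge (N + i) N)) by lia.
replace (N + i - N)%nat with i by lia.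
unfold N. replace (i + 1 + m)%nat with (i + S m)%nat by lia.
rewrite (qpoch_over_pow (/ q ^ 2)), cz_tri by (apply I0 || apply P0).
replace (/ q ^ (4 + 6 * i)) with (/ q ^ 4 * / (q ^ 6) ^ i) at 1
  by (rewrite Cpow_add_r, Cpow_mult_r; field; split; [now apply Cpow_nz | exact Q0]).
rewrite (qpoch_over_pow (/ q ^ 4)), cz_tri by (apply I0 || apply P0).
replace (q ^ 6 * / / q ^ 2) with (q ^ 2 * q ^ 6) by (field; exact Q0).
replace (q ^ 6 * / / q ^ 4) with (q ^ 4 * q ^ 6) by (field; exact Q0).
rewrite (qpoch_S_l (/ q ^ 2)), (qpoch_S_l (/ q ^ 4)).
replace (/ q ^ 2 * q ^ 6) with (q ^ 4) by (field; exact Q0).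
replace (/ q ^ 4 * q ^ 6) with (q ^ 2) by (field; exact Q0).
unfold cz2. assert (E := qpoch_S_l (q ^ 4) (q ^ 6) i). rewrite E.
assert (E' := qpoch_S_l (q ^ 2) (q ^ 6) i). rewrite E'.
assert (E8 : qpoch (q ^ 2 * q ^ 6) (q ^ 6) i <> 0).
{ intros Z. apply (NZ 1%nat (S i)). rewrite E', Z. ring. }
rewrite !Cpow_inv by apply P0.
replace (q ^ (2 * i + 2)) with ((q ^ 2) ^ i * q ^ 2)
  by (rewrite <- Cpow_mult_r, <- !Cpow_add_r; f_equal; lia).
replace ((q ^ 4) ^ i) with ((q ^ 2) ^ i * (q ^ 2) ^ i)
  by (rewrite <- !Cpow_mult_r, <- !Cpow_add_r; f_equal; lia).
rewrite (Cpow_mult_r q (4 + 6 * i) k).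
assert (A1 := NZ 1%nat (S m)). assert (A2 := NZ 3%nat m). assert (A3 := NZ 5%nat i). assert (A4 := NZ 5%nat m).
assert (A5 : (q ^ (4 + 6 * i)) ^ k <> 0) by (apply Cpow_nz, P0).
assert (A6 : (q ^ 2) ^ i <> 0) by (apply Cpow_nz, P0).
assert (A7 := P0 (3 * (i * (i + 1)))%nat). assert (A8 := Cpow_m1_neq_0 i).
assert (A9 : 1 - q ^ 2 <> 0) by apply one_minus_neq_0, HP.
assert (A10 : q ^ 2 - 1 <> 0).
{ intros Z. apply A9. replace (1 - q ^ 2) with (- (q ^ 2 - 1)) by ring. rewrite Z. ring. }
rewrite <- (Cpow_m1_inv i) at 4. field. repeat split; auto.
Qed.

(** * The expansion at x = q^(1-6n) and its limit *)

Lemma Cpowz_neq_1 (q : C) (e : Z) : (0 < Cmod q)%R -> (Cmod q < 1)%R -> (e <> 0)%Z ->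
  1 - Cpowz q e <> 0.
Proof.
intros hq0 hq1 He. assert (Q0 : q <> 0) by now apply Cmod_gt_0.
assert (H : forall n, (0 < n)%nat -> 1 - q ^ n <> 0).
{ intros n Hn. now apply one_minus_neq_0, Cmod_pow_lt_1. }
destruct (Z.lt_trichotomy e 0) as [L|[L|L]]; [|lia|].
- rewrite (Cpowz_nonpos q e (Z.to_nat (- e))) by lia. intros Z.
  apply (H (Z.to_nat (- e)) ltac:(lia)).
  assert (N := Cpow_nz q (Z.to_nat (- e)) Q0).
  transitivity (- q ^ Z.to_nat (- e) * (1 - / q ^ Z.to_nat (- e))); [field; exact N|].
  rewrite Z. ring.
- rewrite (Cpowz_nonneg q e (Z.to_nat e)) by lia. apply H. lia.
Qed.

Lemma Cpow_inj (q : C) (a b : nat) : (0 < Cmod q)%R -> (Cmod q < 1)%R -> q ^ a = q ^ b -> a = b.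
Proof.
intros hq0 hq1 E. destruct (Nat.eq_dec a b) as [|h]; [easy|]. exfalso.
assert (Q0 : q <> 0) by now apply Cmod_gt_0.
apply (Cpowz_neq_1 q (Z.of_nat a - Z.of_nat b) hq0 hq1); [lia|].
rewrite Cpowz_sub, E by exact Q0. unfold Cdiv. rewrite Cinv_r; [ring | now apply Cpow_nz].
Qed.

(** At this x the factors are 1 - q^e with e = 1 + 6j in the numerator and e = 3 + 6j, 5 + 6j in the
    denominator, for -n <= j < n. The map j -> -1-j exchanges 1 + 6j with -(5 + 6j), giving the
    cancellation, and sends 3 + 6j to its negative, giving the square of (q^3;q^6)_n. *)
Lemma cz_finite (q : C) (k : nat) : (0 < Cmod q)%R -> (Cmod q < 1)%R ->
  let n := S k in let N := (n + n)%nat in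
  let x := Cpowz q (1 - 6 * Z.of_nat n) in
  (- (1)) ^ n * (x ^ k * q ^ (3 * (n * (n + 1))) / q ^ (7 * n)) * / qpoch (q ^ 3) (q ^ 6) n ^ 2 =
  csum (fun i => (- (1)) ^ i * (q ^ (3 * (i * (i + 1))) / (q ^ (2 * i + 2) * q ^ ((4 + 6 * i) * k)))
    * cz2 q i (N - 1 - i) / (1 - Cpowz q (6 * (Z.of_nat i - Z.of_nat n) + 5))) N -
  csum (fun i => (- (1)) ^ i * (q ^ (3 * (i * (i + 1))) / (q ^ (4 * i + 2) * q ^ ((2 + 6 * i) * k)))
    * cz1 q i (N - 1 - i) / (1 - Cpowz q (6 * (Z.of_nat i - Z.of_nat n) + 3))) N.
Proof.
intros hq0 hq1 n N x. assert (Q0 : q <> 0) by now apply Cmod_gt_0.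
assert (P0 : forall j, q ^ j <> 0) by (intros; now apply Cpow_nz).
assert (Hx : forall a, q ^ a * x = Cpowz q (Z.of_nat a + (1 - 6 * Z.of_nat n))).
{ intros a. rewrite Cpowz_add, Cpowz_of_nat by exact Q0. easy. }
assert (NZ : forall j l, qpoch (q ^ S j) (q ^ 6) l <> 0).
{ intros j' l. apply qpoch_neq_0. intros r _. apply qpoch_factor_neq_0; apply Cmod_pow_lt_1; auto; lia. }
assert (PF := partial_fractions (cz_pole q N) (cz_num0 N k) (cz_num1 q N k) (N + (k + n)) x).
replace (S (N + (k + n))) with (N + N)%nat in PF by (unfold N, n; lia).
rewrite cz_num_prod, cz_den_prod in PF.
assert (X : forall c : C, c <> 0 -> c * x = c * q * / (q ^ 6) ^ n).
{ intros c _. unfold x. replace (1 - 6 * Z.of_nat n)%Z with (Z.of_nat 1 - Z.of_nat (6 * n))%Z by lia.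
  rewrite Cpowz_sub, Cpow_mult_r, Cpow_1_r by exact Q0. unfold Cdiv. ring. }
assert (L : forall c d : C, c <> 0 -> d = q ^ 6 * / (c * q) -> qpoch (c * x) (q ^ 6) N =
  (- (1)) ^ n * (c * q) ^ n * / q ^ (3 * (n * (n + 1))) * (qpoch d (q ^ 6) n * qpoch (c * q) (q ^ 6) n)).
{ intros c d Hc ->. rewrite X by exact Hc. unfold N. rewrite qpoch_over_pow, cz_tri by (apply P0 || now apply Cmult_neq_0).
  easy. }
(* Reflection pairs base q with q^5 and q^3 with itself, so [L1] and [L4] contain the same two
   symbols and [L2] contains one of them squared. *)
assert (L1 := L 1 (q ^ 5) C1_nz ltac:(field; exact Q0)). rewrite !Cmult_1_l in L1.
assert (L2 := L (q ^ 2) (q ^ 3) ltac:(apply P0) ltac:(field; exact Q0)).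
assert (L4 := L (q ^ 4) q ltac:(apply P0) ltac:(field; exact Q0)).
replace (q ^ 2 * q) with (q ^ 3) in L2 by ring. replace (q ^ 4 * q) with (q ^ 5) in L4 by ring.
transitivity (qpoch x (q ^ 6) N * x ^ k / (qpoch (q ^ 2 * x) (q ^ 6) N * qpoch (q ^ 4 * x) (q ^ 6) N)).
{ rewrite L1, L2, L4.
  replace (q ^ (7 * n)) with (q ^ n * q ^ n * q ^ n * q ^ n * q ^ n * q ^ n * q ^ n)
    by (rewrite <- !Cpow_add_r; f_equal; lia).
  replace ((q ^ 3) ^ n) with (q ^ n * q ^ n * q ^ n)
    by (rewrite <- Cpow_mult_r, <- !Cpow_add_r; f_equal; lia).
  replace ((q ^ 5) ^ n) with (q ^ n * q ^ n * q ^ n * q ^ n * q ^ n)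
    by (rewrite <- Cpow_mult_r, <- !Cpow_add_r; f_equal; lia).
  assert (A1 := NZ 2%nat n). assert (A2 := NZ 4%nat n).
  assert (A3 := NZ 0%nat n). rewrite Cpow_1_r in A3.
  assert (A4 := P0 (3 * (n * (n + 1)))%nat). assert (A5 := Cpow_m1_neq_0 n). assert (A6 := P0 n).
  rewrite <- (Cpow_m1_inv n) at 1. field. repeat split; auto. }
rewrite PF.
- rewrite csum_add, Cplus_comm. unfold Cminus.
  f_equal; [|rewrite <- csum_opp];
  apply csum_ext; intros i Hi.
  + assert (E := cz_coef2 q i (N - 1 - i) k n hq0 hq1). cbv zeta in E.
    replace (i + 1 + (N - 1 - i))%nat with N in E by lia. rewrite E by (unfold N, n; lia).
    unfold cz_pole. rewrite (proj2 (Nat.ltb_ge (N + i) N)) by lia. rewrite Hx.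
    replace (Z.of_nat (4 + 6 * (N + i - N)) + (1 - 6 * Z.of_nat n))%Z
      with (6 * (Z.of_nat i - Z.of_nat n) + 5)%Z by lia. easy.
  + assert (E := cz_coef1 q i (N - 1 - i) k n hq0 hq1). cbv zeta in E.
    replace (i + 1 + (N - 1 - i))%nat with N in E by lia. rewrite E by (unfold N, n; lia).
    unfold cz_pole. rewrite (proj2 (Nat.ltb_lt i N)) by lia. rewrite Hx.
    replace (Z.of_nat (2 + 6 * i) + (1 - 6 * Z.of_nat n))%Z
      with (6 * (Z.of_nat i - Z.of_nat n) + 3)%Z by lia. unfold Cdiv. ring.
- intros. apply P0.
- intros i j Hi Hj Hij E. apply Hij. unfold cz_pole in E. apply Cpow_inj in E; auto.
  destruct (Nat.ltb_spec i N), (Nat.ltb_spec j N); lia.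
- intros i Hi. unfold cz_pole. rewrite Hx. apply Cpowz_neq_1; auto.
  destruct (Nat.ltb_spec i N); lia.
Qed.

(** Gathers all powers of q into a single integer exponent, so that comparing terms becomes integer
    arithmetic. *)
Lemma cz_exponents (q A D : C) (n k i a b : nat) : (0 < Cmod q)%R ->
  (- (1)) ^ n * Cpowz q (7 * Z.of_nat n - (1 - 6 * Z.of_nat n) * Z.of_nat k - 3 * Z.of_nat n * (Z.of_nat n + 1))
  * ((- (1)) ^ i * (q ^ (3 * (i * (i + 1))) / (q ^ a * q ^ (b * k))) * A / D) =
  (- (1)) ^ (n + i) * Cpowz q (7 * Z.of_nat n - (1 - 6 * Z.of_nat n) * Z.of_nat k
    - 3 * Z.of_nat n * (Z.of_nat n + 1) + 3 * Z.of_nat i * (Z.of_nat i + 1)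
    - Z.of_nat a - Z.of_nat b * Z.of_nat k) * A / D.
Proof.
intros hq0. assert (Q0 : q <> 0) by now apply Cmod_gt_0.
replace (q ^ (3 * (i * (i + 1))) / (q ^ a * q ^ (b * k)))
  with (Cpowz q (Z.of_nat (3 * (i * (i + 1))) - Z.of_nat (a + b * k)))
  by (rewrite Cpowz_sub, Cpow_add_r by exact Q0; easy).
match goal with |- _ = _ * Cpowz q ?e * A / D =>
  replace e with (7 * Z.of_nat n - (1 - 6 * Z.of_nat n) * Z.of_nat k - 3 * Z.of_nat n * (Z.of_nat n + 1)
   + (Z.of_nat (3 * (i * (i + 1))) - Z.of_nat (a + b * k)))%Z by lia end.
rewrite (Cpowz_add q _ (Z.of_nat (3 * (i * (i + 1))) - Z.of_nat (a + b * k))), Cpow_add_r by exact Q0.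
unfold Cdiv. ring.
Qed.

Lemma Cpowz_pow_r (x : C) (a : Z) (n : nat) : x <> 0 -> Cpowz x a ^ n = Cpowz x (a * Z.of_nat n).
Proof.
intros Hx. induction n as [|n IH]; [now rewrite Z.mul_0_r|].
rewrite Cpow_S, IH, <- Cpowz_add by exact Hx. f_equal. lia.
Qed.

Lemma Cpow_m1_even (n s : nat) : (- (1)) ^ (n + (n + s)) = (- (1)) ^ s.
Proof. rewrite !Cpow_add_r, Cmult_assoc, Cpow_m1_sq. ring. Qed.

(** For the poles on the lower side of the middle: clears the negative power of q in the
    denominator. *)
Lemma cz_neg_denominator (q A : C) (s e j : nat) : (0 < Cmod q)%R -> (Cmod q < 1)%R ->
  - (- (1)) ^ s * Cpowz q (Z.of_nat e - Z.of_nat (S j)) * A / (1 - / q ^ S j)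
  = (- (1)) ^ s * q ^ e / (1 - q ^ S j) * A.
Proof.
intros hq0 hq1. assert (Q0 : q <> 0) by now apply Cmod_gt_0.
assert (N := Cpow_nz q (S j) Q0).
assert (X : 1 - q ^ S j <> 0) by (apply one_minus_neq_0, Cmod_pow_lt_1; [exact hq1 | lia]).
rewrite Cpowz_sub by exact Q0. field. repeat split; auto.
intros Z. apply X. rewrite <- Copp_0, <- Z. ring.
Qed.

(** [cz_finite] normalised and folded about the middle, with i = n + s and i = n - 1 - s. The
    exponents become independent of n: the 6ns arising from 3i(i+1) is cancelled, up to 6s, by the
    -6sk due to x^k, since k = n - 1. *)
Lemma cz_identity (q : C) (k : nat) : (0 < Cmod q)%R -> (Cmod q < 1)%R ->
  let n := S k in
  / qpoch (q ^ 3) (q ^ 6) n ^ 2 =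
  csum (fun s =>
    (lambert q 7 3 5 s * cz2 q (n + s) (k - s) + lambert q 5 0 1 s * cz2 q (k - s) (n + s)) -
    (lambert q 5 1 3 s * cz1 q (n + s) (k - s) + lambert q 7 2 3 s * cz1 q (k - s) (n + s))) n.
Proof.
intros hq0 hq1 n. assert (Q0 : q <> 0) by now apply Cmod_gt_0.
assert (F := cz_finite q k hq0 hq1). cbv zeta in F. fold n in F.
set (F2 := fun i => (- (1)) ^ i * (q ^ (3 * (i * (i + 1))) / (q ^ (2 * i + 2) * q ^ ((4 + 6 * i) * k)))
    * cz2 q i (n + n - 1 - i) / (1 - Cpowz q (6 * (Z.of_nat i - Z.of_nat n) + 5))) in F.
set (F1 := fun i => (- (1)) ^ i * (q ^ (3 * (i * (i + 1))) / (q ^ (4 * i + 2) * q ^ ((2 + 6 * i) * k)))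
    * cz1 q i (n + n - 1 - i) / (1 - Cpowz q (6 * (Z.of_nat i - Z.of_nat n) + 3))) in F.
set (K := (- (1)) ^ n * Cpowz q (7 * Z.of_nat n - (1 - 6 * Z.of_nat n) * Z.of_nat k
  - 3 * Z.of_nat n * (Z.of_nat n + 1))).
transitivity (K * (csum F2 (n + n) - csum F1 (n + n))).
{ rewrite <- F, Cpowz_pow_r by exact Q0.
  set (e := ((1 - 6 * Z.of_nat n) * Z.of_nat k)%Z) in *.
  assert (E : Cpowz q (7 * Z.of_nat n - e - 3 * Z.of_nat n * (Z.of_nat n + 1))
    * (Cpowz q e * q ^ (3 * (n * (n + 1)))) = q ^ (7 * n)).
  { rewrite <- !Cpowz_of_nat, <- !Cpowz_add by exact Q0. f_equal. lia. }
  unfold K. unfold Cdiv.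
  transitivity ((- (1)) ^ n * (- (1)) ^ n * (q ^ (7 * n) * / q ^ (7 * n))
    * / qpoch (q ^ 3) (q ^ 6) n ^ 2).
  - rewrite Cpow_m1_sq, Cinv_r by now apply Cpow_nz. ring.
  - rewrite <- E at 1. ring. }
rewrite !csum_add, (csum_rev F2 n), (csum_rev F1 n).
unfold Cminus. rewrite <- !csum_plus, <- csum_opp, <- csum_plus, <- csum_scal.
apply csum_ext. intros s Hs.
assert (T2 : K * F2 (n + s)%nat = lambert q 7 3 5 s * cz2 q (n + s) (k - s)).
{ unfold K, F2. rewrite cz_exponents, Cpow_m1_even by exact hq0.
  rewrite (Cpowz_nonneg q _ (3 * s ^ 2 + 7 * s + 3)), (Cpowz_nonneg q _ (6 * s + 5))
    by (unfold n; simpl Nat.pow; nia).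
  replace (n + n - 1 - (n + s))%nat with (k - s)%nat by (unfold n; lia).
  unfold lambert, Cdiv. ring. }
assert (T1 : K * F1 (n + s)%nat = lambert q 5 1 3 s * cz1 q (n + s) (k - s)).
{ unfold K, F1. rewrite cz_exponents, Cpow_m1_even by exact hq0.
  rewrite (Cpowz_nonneg q _ (3 * s ^ 2 + 5 * s + 1)), (Cpowz_nonneg q _ (6 * s + 3))
    by (unfold n; simpl Nat.pow; nia).
  replace (n + n - 1 - (n + s))%nat with (k - s)%nat by (unfold n; lia).
  unfold lambert, Cdiv. ring. }
assert (Sg : (- (1)) ^ (n + (k - s)) = - (- (1)) ^ s).
{ rewrite <- (Cpow_m1_even (k - s) s). replace (n + (k - s))%nat with (S (k - s + (k - s + s))) by (unfold n; lia).
  rewrite Cpow_S. ring. }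
assert (T2' : K * F2 (n - 1 - s)%nat = lambert q 5 0 1 s * cz2 q (k - s) (n + s)).
{ replace (n - 1 - s)%nat with (k - s)%nat by (unfold n; lia).
  unfold K, F2. rewrite cz_exponents, Sg by exact hq0.
  replace (n + n - 1 - (k - s))%nat with (n + s)%nat by (unfold n; lia).
  rewrite (Cpowz_nonpos q (6 * _ + 5) (S (6 * s))) by (unfold n; lia).
  match goal with |- _ * Cpowz q ?e * _ / _ = _ =>
    replace e with (Z.of_nat (3 * s ^ 2 + 5 * s + 0) - Z.of_nat (S (6 * s)))%Z
      by (unfold n; simpl Nat.pow; nia) end.
  rewrite cz_neg_denominator by assumption. unfold lambert. now rewrite (Nat.add_1_r (6 * s)). }
assert (T1' : K * F1 (n - 1 - s)%nat = lambert q 7 2 3 s * cz1 q (k - s) (n + s)).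
{ replace (n - 1 - s)%nat with (k - s)%nat by (unfold n; lia).
  unfold K, F1. rewrite cz_exponents, Sg by exact hq0.
  replace (n + n - 1 - (k - s))%nat with (n + s)%nat by (unfold n; lia).
  rewrite (Cpowz_nonpos q (6 * _ + 3) (S (6 * s + 2))) by (unfold n; lia).
  match goal with |- _ * Cpowz q ?e * _ / _ = _ =>
    replace e with (Z.of_nat (3 * s ^ 2 + 7 * s + 2) - Z.of_nat (S (6 * s + 2)))%Z
      by (unfold n; simpl Nat.pow; nia) end.
  rewrite cz_neg_denominator by assumption. unfold lambert.
  now replace (6 * s + 3)%nat with (S (6 * s + 2)) by lia. }
rewrite <- T1, <- T2, <- T1', <- T2'. ring.
Qed.

(** The two inputs of Tannery's theorem for [cz1] and [cz2] together: a uniform bound and the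
    termwise limit. Independent indices absorb the different placement of successors; swapping a and
    b passes from one to the other. *)
Lemma cz_ratio_lim_bound (a b p : C) : (Cmod a < 1)%R -> (Cmod b < 1)%R -> (Cmod p < 1)%R ->
  let r := fun i m i' j j' => qpoch a p i' * qpoch b p m
    / (qpoch p p i * qpoch p p m * qpoch b p j * qpoch a p j') in
  (exists M, forall i m i' j j', (Cmod (r i m i' j j') <= M)%R) /\
  (forall i m i' j j' : nat -> nat, forall l,
     (forall n, (n <= i n + l)%nat) -> (forall n, (n <= m n + l)%nat) ->
     (forall n, (n <= i' n + l)%nat) -> (forall n, (n <= j n + l)%nat) ->
     (forall n, (n <= j' n + l)%nat) ->
     Clim (fun n => r (i n) (m n) (i' n) (j n) (j' n)) (/ qpoch_inf p p ^ 2)).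
Proof.
intros Ha Hb Hp r.
assert (Fa := qpoch_factor_neq_0 a p Ha Hp). assert (Fb := qpoch_factor_neq_0 b p Hb Hp).
assert (Fp := qpoch_factor_neq_0 p p Hp Hp).
assert (Na := qpoch_inf_neq_0 a p Hp Fa). assert (Nb := qpoch_inf_neq_0 b p Hp Fb).
assert (Np := qpoch_inf_neq_0 p p Hp Fp).
assert (Za : forall n, qpoch a p n <> 0) by (intros; apply qpoch_neq_0; auto).
assert (Zb : forall n, qpoch b p n <> 0) by (intros; apply qpoch_neq_0; auto).
assert (Zp : forall n, qpoch p p n <> 0) by (intros; apply qpoch_neq_0; auto).
split.
- destruct (qpoch_bounded a p Hp) as [A [HA BA]]. destruct (qpoch_bounded b p Hp) as [B [HB BB]].
  destruct (qpoch_inv_bounded a p Hp Fa) as [A' [HA' BA']].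
  destruct (qpoch_inv_bounded b p Hp Fb) as [B' [HB' BB']].
  destruct (qpoch_inv_bounded p p Hp Fp) as [P' [HP' BP']].
  exists (A * B * (P' * P' * B' * A'))%R.
  intros i m i' j j'. unfold r.
  replace (qpoch a p i' * qpoch b p m / (qpoch p p i * qpoch p p m * qpoch b p j * qpoch a p j'))
    with (qpoch a p i' * qpoch b p m * (/ qpoch p p i * / qpoch p p m * / qpoch b p j * / qpoch a p j'))
    by (field; auto).
  rewrite !Cmod_mult.
  repeat (apply Rmult_le_compat; [repeat apply Rmult_le_pos; apply Cmod_ge_0
    | repeat apply Rmult_le_pos; apply Cmod_ge_0 | |]); auto.
- intros i m i' j j' l Hi Hm Hi' Hj Hj'.
  replace (/ qpoch_inf p p ^ 2) with (qpoch_inf a p * qpoch_inf b p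
    / (qpoch_inf p p * qpoch_inf p p * qpoch_inf b p * qpoch_inf a p)) by (field; auto).
  unfold r. apply Clim_div; [repeat apply Cmult_neq_0; assumption | |];
  repeat apply Clim_mult.
  + apply (Clim_subseq _ _ i' l Hi'). now apply qpoch_inf_lim.
  + apply (Clim_subseq _ _ m l Hm). now apply qpoch_inf_lim.
  + apply (Clim_subseq _ _ i l Hi). now apply qpoch_inf_lim.
  + apply (Clim_subseq _ _ m l Hm). now apply qpoch_inf_lim.
  + apply (Clim_subseq _ _ j l Hj). now apply qpoch_inf_lim.
  + apply (Clim_subseq _ _ j' l Hj'). now apply qpoch_inf_lim.
Qed.

(* The case x = q, p = q^6, z1 = q^4, z0 = q^2 of the change-of-z formula for
   m(x,p,z1) - m(x,p,z0). *)
Lemma change_of_z (q : C) : (0 < Cmod q)%R -> (Cmod q < 1)%R ->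
  CSeries (bailey_alpha (q ^ 3)) =
  (CSeries (lambert q 7 3 5) + CSeries (lambert q 5 0 1))
  - (CSeries (lambert q 5 1 3) + CSeries (lambert q 7 2 3)).
Proof.
intros hq0 hq1. pose proof (Cmod_ge_0 q) as Q0.
assert (HP : forall j, (Cmod (q ^ S j) < 1)%R) by (intros; apply Cmod_pow_lt_1; [exact hq1 | lia]).
assert (F3 := qpoch_factor_neq_0 _ _ (HP 2%nat) (HP 5%nat)).
assert (N3 := qpoch_inf_neq_0 _ _ (HP 5%nat) F3).
assert (N6 := qpoch_inf_neq_0 _ _ (HP 5%nat) (qpoch_factor_neq_0 _ _ (HP 5%nat) (HP 5%nat))).
destruct (bailey_pair_limit (q ^ 3) (HP 2%nat)) as [_ E].
replace ((q ^ 3) ^ 2) with (q ^ 6) in E by ring. rewrite E. clear E.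
set (W := / qpoch_inf (q ^ 6) (q ^ 6) ^ 2).
destruct (cz_ratio_lim_bound (q ^ 2) (q ^ 4) (q ^ 6) (HP 1%nat) (HP 3%nat) (HP 5%nat)) as [[M1 B1] L1].
destruct (cz_ratio_lim_bound (q ^ 4) (q ^ 2) (q ^ 6) (HP 3%nat) (HP 1%nat) (HP 5%nat)) as [[M2 B2] L2].
cbv zeta in B1, L1, B2, L2. fold W in L1, L2.
assert (D1 : forall i m, (Cmod (cz1 q i m) <= M1)%R) by (intros i m; apply (B1 i m (S i) i (S m))).
assert (D2 : forall i m, (Cmod (cz2 q i m) <= M2)%R) by (intros i m; apply (B2 i m (S i) (S i) m)).
assert (G1 : forall i m l, (forall n, (n <= i n + l)%nat) -> (forall n, (n <= m n + l)%nat) ->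
  Clim (fun n => cz1 q (i n) (m n)) W).
{ intros i m l Hi Hm. apply (L1 i m (fun n => S (i n)) i (fun n => S (m n)) l); auto;
  intros n; specialize (Hi n); specialize (Hm n); lia. }
assert (G2 : forall i m l, (forall n, (n <= i n + l)%nat) -> (forall n, (n <= m n + l)%nat) ->
  Clim (fun n => cz2 q (i n) (m n)) W).
{ intros i m l Hi Hm. apply (L2 i m (fun n => S (i n)) (fun n => S (i n)) m l); auto;
  intros n; specialize (Hi n); specialize (Hm n); lia. }
assert (W1 : (Cmod W <= M1)%R).
{ apply (Clim_Cmod_le _ _ _ (G1 (fun n => n) (fun n => n) 0%nat ltac:(intros; lia) ltac:(intros; lia))).
  intros; apply D1. }
assert (W2 : (Cmod W <= M2)%R).
{ apply (Clim_Cmod_le _ _ _ (G2 (fun n => n) (fun n => n) 0%nat ltac:(intros; lia) ltac:(intros; lia))).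
  intros; apply D2. }
set (R := (/ (1 - Cmod q))%R).
assert (BB : forall c d k z M n, (Cmod z <= M)%R -> (Cmod (lambert q c d (S k) n * z) <= R * M * Cmod q ^ n)%R).
{ intros c d k z M n Hz. rewrite Cmod_mult. replace (R * M * Cmod q ^ n)%R with (R * Cmod q ^ n * M)%R by ring.
  apply Rmult_le_compat; auto using Cmod_ge_0. now apply lambert_bound. }
assert (B4 : forall n z1 z2 z3 z4, (Cmod z1 <= M2)%R -> (Cmod z2 <= M2)%R -> (Cmod z3 <= M1)%R -> (Cmod z4 <= M1)%R ->
  (Cmod ((lambert q 7 3 5 n * z1 + lambert q 5 0 1 n * z2)
     - (lambert q 5 1 3 n * z3 + lambert q 7 2 3 n * z4)) <= (2 * (R * M1) + 2 * (R * M2)) * Cmod q ^ n)%R).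
{ intros n z1 z2 z3 z4 H1 H2 H3 H4.
  eapply Rle_trans; [apply Cmod_triangle|]. rewrite Cmod_opp.
  pose proof (Cmod_triangle (lambert q 7 3 5 n * z1) (lambert q 5 0 1 n * z2)).
  pose proof (Cmod_triangle (lambert q 5 1 3 n * z3) (lambert q 7 2 3 n * z4)).
  pose proof (BB 7 3 4 z1 M2 n H1)%nat. pose proof (BB 5 0 0 z2 M2 n H2)%nat.
  pose proof (BB 5 1 2 z3 M1 n H3)%nat. pose proof (BB 7 2 2 z4 M1 n H4)%nat. lra. }
(* For fixed s both k - s and k + 1 + s tend to infinity, so every [cz1] and [cz2] tends to [W] and
   only the Lambert terms keep s. *)
assert (T := Clim_tannery (fun k s =>
    (lambert q 7 3 5 s * cz2 q (S k + s) (k - s) + lambert q 5 0 1 s * cz2 q (k - s) (S k + s)) -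
    (lambert q 5 1 3 s * cz1 q (S k + s) (k - s) + lambert q 7 2 3 s * cz1 q (k - s) (S k + s)))
  (fun s => (lambert q 7 3 5 s * W + lambert q 5 0 1 s * W) - (lambert q 5 1 3 s * W + lambert q 7 2 3 s * W))
  (2 * (R * M1) + 2 * (R * M2)) (Cmod q) (conj Q0 hq1)).
assert (T' : Clim (fun k => / qpoch (q ^ 3) (q ^ 6) (S k) ^ 2) (CSeries
  (fun s => (lambert q 7 3 5 s * W + lambert q 5 0 1 s * W) - (lambert q 5 1 3 s * W + lambert q 7 2 3 s * W)))).
{ eapply Clim_ext; [|apply T].
  - intros k. symmetry. now apply cz_identity.
  - intros k s _. apply B4; auto.
  - intros s. repeat apply Clim_plus; try apply Clim_opp; repeat apply Clim_plus;
    apply Clim_scal;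
    first [apply (G2 (fun k => S k + s) (fun k => k - s) s)%nat | apply (G2 (fun k => k - s) (fun k => S k + s) s)%nat
     | apply (G1 (fun k => S k + s) (fun k => k - s) s)%nat | apply (G1 (fun k => k - s) (fun k => S k + s) s)%nat];
    intros; lia.
  - intros s. apply B4; auto. }
assert (S' : CSeries (fun s => (lambert q 7 3 5 s * W + lambert q 5 0 1 s * W)
    - (lambert q 5 1 3 s * W + lambert q 7 2 3 s * W)) =
  W * ((CSeries (lambert q 7 3 5) + CSeries (lambert q 5 0 1))
  + - (1) * (CSeries (lambert q 5 1 3) + CSeries (lambert q 7 2 3)))).
{ apply CSeries_unique. eapply csum_lim_ext; [|apply csum_lim_scal, csum_lim_plus;
    [|apply csum_lim_scal]; apply csum_lim_plus; apply CSeries_correct; now apply ex_series_lambert_q].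
  intros s. cbv beta. ring. }
rewrite S' in T'.
assert (U : Clim (fun k => / qpoch (q ^ 3) (q ^ 6) (S k) ^ 2) (/ qpoch_inf (q ^ 3) (q ^ 6) ^ 2)).
{ apply Clim_inv; [now apply Cpow_nz|].
  apply (Clim_ext (fun k => qpoch (q ^ 3) (q ^ 6) (S k) * qpoch (q ^ 3) (q ^ 6) (S k))); [intros; ring|].
  replace (qpoch_inf (q ^ 3) (q ^ 6) ^ 2) with (qpoch_inf (q ^ 3) (q ^ 6) * qpoch_inf (q ^ 3) (q ^ 6)) by ring.
  apply Clim_mult; apply (Clim_subseq _ _ S 0); (intros; lia) || apply qpoch_inf_lim, (HP 5%nat). }
(* Two limits of 1/(q^3;q^6)_(k+1)^2: the infinite product and [W] times the Lambert series. *)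
assert (V := Clim_unique _ _ _ U T').
unfold Cdiv. rewrite V. unfold W. field. exact N6.
Qed.

(** * The theorem *)

Lemma qpoch_triple (x p : C) (n : nat) :
  qpoch x p (3 * n) = qpoch x (p ^ 3) n * qpoch (x * p) (p ^ 3) n * qpoch (x * p ^ 2) (p ^ 3) n.
Proof.
induction n as [|n IH]; [simpl; ring|].
replace (3 * S n)%nat with (S (S (S (3 * n)))) by lia. cbn [qpoch]. rewrite IH.
rewrite <- Cpow_mult_r, !Cpow_S. ring.
Qed.

Lemma qpoch_inf_triple (x p : C) : (Cmod p < 1)%R ->
  qpoch_inf x p = qpoch_inf x (p ^ 3) * qpoch_inf (x * p) (p ^ 3) * qpoch_inf (x * p ^ 2) (p ^ 3).
Proof.
intros Hp. assert (Hp3 : (Cmod (p ^ 3) < 1)%R) by (apply Cmod_pow_lt_1; [exact Hp | lia]).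
apply (Clim_unique (fun n => qpoch x p (3 * n))).
- apply (Clim_subseq _ _ (fun n => 3 * n)%nat 0); [intros; lia | now apply qpoch_inf_lim].
- eapply Clim_ext; [intros n; symmetry; apply qpoch_triple|].
  repeat apply Clim_mult; now apply qpoch_inf_lim.
Qed.

(** The three factors of j(q^2;q^6) collect the exponents 2, 4 and 0 modulo 6, that is, all even
    ones. Hence both Appell-Lerch sums have the prefactor 1/J_2. *)
Lemma theta_q2 (q : C) : (0 < Cmod q)%R -> (Cmod q < 1)%R ->
  theta (q ^ 2) (q ^ 6) = qpoch_inf (q ^ 2) (q ^ 2).
Proof.
intros hq0 hq1. assert (Q0 : q <> 0) by now apply Cmod_gt_0.
assert (Hp : (Cmod (q ^ 2) < 1)%R) by (apply Cmod_pow_lt_1; [exact hq1 | lia]).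
rewrite (qpoch_inf_triple (q ^ 2) (q ^ 2) Hp). unfold theta.
replace (q ^ 6 / q ^ 2) with (q ^ 2 * q ^ 2) by (field; exact Q0).
replace ((q ^ 2) ^ 3) with (q ^ 6) by ring. now replace (q ^ 2 * (q ^ 2) ^ 2) with (q ^ 6) by ring.
Qed.

Lemma theta_inv (x p : C) : x <> 0 -> p <> 0 -> theta (p / x) p = theta x p.
Proof.
intros Hx Hp. unfold theta. replace (p / (p / x)) with x by (field; auto). ring.
Qed.

(** Everything is linear in [A] and [B], where -m(q,q^6,q^4)/q = A/J_2 and -m(q,q^6,q^2)/q = B/J_2:
    the series is (A - B) + 2B = A + B. *)
Lemma third_sum_second_identity (q : C) (hq0 : (0 < Cmod q)%R) (hq1 : (Cmod q < 1)%R) :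
  let t := fun n : nat =>
     (- (1)) ^ n * ((1 + q ^ (2 * n + 1)) / (1 - q ^ (2 * n + 1))) * q ^ (3 * n ^ 2 + 3 * n) in
  ex_series_Z (m_term q (q ^ 6) (q ^ 2)) /\ ex_series_Z (m_term q (q ^ 6) (q ^ 4)) /\
  1 / qpoch_inf (q ^ 2) (q ^ 2) * CSeries t =
     - (/ q * m q (q ^ 6) (q ^ 2)) - / q * m q (q ^ 6) (q ^ 4) /\
  - (/ q * m q (q ^ 6) (q ^ 2)) - / q * m q (q ^ 6) (q ^ 4) =
     - (2 * / q * m q (q ^ 6) (q ^ 2)) + J1 q 6 ^ 3 / (J1 q 2 * J2 q 3 6).
Proof.
intros t. assert (Q0 : q <> 0) by now apply Cmod_gt_0.
assert (HP : forall j, (Cmod (q ^ S j) < 1)%R) by (intros; apply Cmod_pow_lt_1; [exact hq1 | lia]).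
assert (N : forall i j, qpoch_inf (q ^ S i) (q ^ S j) <> 0).
{ intros i j. apply qpoch_inf_neq_0; [apply HP | apply qpoch_factor_neq_0; apply HP]. }
assert (N2 := N 1%nat 1%nat). assert (N3 := N 2%nat 5%nat). assert (N6 := N 5%nat 5%nat).
destruct (third_sum_lambert q hq0 hq1) as [[EA EA'] [[EB EB'] ET]].
destruct (bailey_pair_limit (q ^ 3) (HP 2%nat)) as [_ L].
replace ((q ^ 3) ^ 2) with (q ^ 6) in L by ring.
assert (Z := change_of_z q hq0 hq1).
set (A := CSeries (lambert q 7 3 5) + CSeries (lambert q 5 0 1)) in *.
set (B := CSeries (lambert q 5 1 3) + CSeries (lambert q 7 2 3)) in *.
assert (Tt : CSeries t = A + B) by (unfold t; rewrite ET, Z; ring).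
assert (T4 : theta (q ^ 4) (q ^ 6) = qpoch_inf (q ^ 2) (q ^ 2)).
{ rewrite <- theta_q2, <- (theta_inv (q ^ 2)) by (assumption || now apply Cpow_nz).
  f_equal. field. exact Q0. }
assert (M2 : m q (q ^ 6) (q ^ 2) = / qpoch_inf (q ^ 2) (q ^ 2) * (- q * B))
  by (unfold m; rewrite theta_q2, EB' by assumption; easy).
assert (M4 : m q (q ^ 6) (q ^ 4) = / qpoch_inf (q ^ 2) (q ^ 2) * (- q * A))
  by (unfold m; rewrite T4, EA'; easy).
split; [exact EB | split; [exact EA|]].
rewrite M2, M4, Tt. split; [field; auto|].
unfold J1, J2, theta. replace (q ^ 6 / q ^ 3) with (q ^ 3) by (field; exact Q0).
(* The difference A - B is J_6^3/J_{3,6}, by [change_of_z] and the limit of the Bailey pair at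
   q^3. *)
transitivity (/ qpoch_inf (q ^ 2) (q ^ 2) * (2 * B + (A - B))); [field; auto|].
rewrite <- Z, L. field. repeat split; auto.
Qed.

Theorem corollary4p3 (q : C) (hq0 : (0 < Cmod q)%R) (hq1 : (Cmod q < 1)%R) :
  (* (i) *)
  (let s := fun n : nat =>
     (- (1)) ^ n * q ^ (2 * n ^ 2 + 3 * n) / (1 - q ^ (2 * n + 1)) in
   ex_series (A2_term q) /\ ex_series s /\
   A2 q = q * (qpoch_inf (- q) (q ^ 2) / qpoch_inf (q ^ 2) (q ^ 2))
            * CSeries s) /\
  (* (ii) *)
  (let s := fun n : Z =>
     Cpowz (- (1)) n * Cpowz q (2 * n ^ 2 + 2 * n)
       / (1 - Cpowz q (2 * n + 1)) in
   ex_series (B2_term q) /\ ex_series_Z s /\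
   B2 q = qpoch_inf (- q ^ 2) (q ^ 2) / qpoch_inf (q ^ 2) (q ^ 2)
            * CSeries_Z s) /\
  (* (iii) *)
  (let s := fun n : nat =>
     q ^ (2 * n * (n + 1)) / qpoch q (q ^ 2) (n + 1) ^ 2 in
   let t := fun n : nat =>
     (- (1)) ^ n * ((1 + q ^ (2 * n + 1)) / (1 - q ^ (2 * n + 1)))
       * q ^ (3 * n ^ 2 + 3 * n) in
   ex_series s /\ ex_series t /\
   ex_series_Z (m_term q (q ^ 6) (q ^ 2)) /\
   ex_series_Z (m_term q (q ^ 6) (q ^ 4)) /\
   CSeries s = 1 / qpoch_inf (q ^ 2) (q ^ 2) * CSeries t /\
   1 / qpoch_inf (q ^ 2) (q ^ 2) * CSeries t =
     - (/ q * m q (q ^ 6) (q ^ 2)) - / q * m q (q ^ 6) (q ^ 4) /\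
   - (/ q * m q (q ^ 6) (q ^ 2)) - / q * m q (q ^ 6) (q ^ 4) =
     - (2 * / q * m q (q ^ 6) (q ^ 2)) + J1 q 6 ^ 3 / (J1 q 2 * J2 q 3 6)) /\
  (* (iv) *)
  (let s := fun n : nat =>
     (- (1)) ^ n * q ^ (n * (n + 1)) * qpoch (q ^ 2) (q ^ 2) n
       / qpoch q (q ^ 2) (n + 1) ^ 2 in
   let t := fun n : nat =>
     (1 + q ^ (2 * n + 1)) / (1 - q ^ (2 * n + 1)) * q ^ (2 * n ^ 2 + 2 * n) in
   ex_series s /\ ex_series t /\
   ex_series_Z (mbar_term (- q ^ 2) (q ^ 4) (- q ^ 4)) /\
   ex_series_Z (mbar_term (- (1)) (q ^ 4) (- q ^ 6)) /\
   CSeries s = CSeries t /\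
   CSeries t =
     mbar (- q ^ 2) (q ^ 4) (- q ^ 4) + q * mbar (- (1)) (q ^ 4) (- q ^ 6)).
Proof.
split; [|split; [|split]].
- now apply A2_identity.
- now apply B2_identity.
- destruct (third_sum_first_identity q hq0 hq1) as [Es [Et E]].
  destruct (third_sum_second_identity q hq0 hq1) as [E2 [E4 [F G]]].
  intros s t. repeat split; assumption || apply E2 || apply E4.
- destruct (fourth_sum_first_identity q hq0 hq1) as [Es [Et E]].
  destruct (fourth_sum_mbar q hq0 hq1) as [E2 [E4 F]].
  intros s t. repeat split; assumption || apply E2 || apply E4.
Qed.
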